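(* Let $f=\frac1n\sum_{i=1}^nf_i:\mathbb{R}^d\to\mathbb{R}$ be convex, $\mu$-quasi strongly convex with $\mu\ge0$ (with unique minimizer $x^*$) and $L$-smooth, let each $f_i$ have the finite-sum form $f_i=\frac1m\sum_{j=1}^mf_{ij}$, and let the Expected Smoothness assumption hold with constant $\mathcal{L}>0$ for the sampling distributions $\mathcal{D}_1,\dots,\mathcal{D}_n$. Let $R_0=\|x^0-x^*\|$ and $\sigma_*^2=\frac1n\sum_{i=1}^n\mathbb{E}_{\xi_i\sim\mathcal{D}_i}[\|\nabla f_{\xi_i}(x^* )-\nabla f_i(x^* )\|^2]$. Then for every $K\ge1$ there exists a choice of stepsize $0<\gamma\le(4L+\frac{8\mathcal{L}}{n})^{-1}$ (possibly depending on $K$) such that EC-SGD-AS with an absolute compression operator with constant $\Delta\ge0$ guarantees that $\mathbb{E}[f(\overline{x}^K)-f(x^* )]$ is of the order $$\widetilde{\mathcal{O}}\left(\left(L+\frac{\mathcal{L}}{n}\right)R_0^2\exp\left(-\frac{\mu}{L+\mathcal{L}/n}K\right)+\frac{\sigma_*^2}{\mu nK}+\frac{L\Delta^2}{\mu^2K^2}\right)\quad\text{when }\mu>0,$$ $$\mathcal{O}\left(\frac{(L+\mathcal{L}/n)R_0^2}{K}+\sqrt{\frac{\sigma_*^2R_0^2}{nK}}+\frac{L^{1/3}R_0^{4/3}\Delta^{2/3}}{K^{2/3}}\right)\quad\text{when }\mu=0.$$ Here $\overline{x}^K=\frac1{W_K}\sum_{k=0}^Kw_kx^k$, $w_k=(1-\eta)^{-(k+1)}$,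 $W_K=\sum_{k=0}^Kw_k$, $\eta=\min\{\frac{\gamma\mu}{2},\frac14\}$.
   Context: Problem: minimize $f(x)=\frac1n\sum_{i=1}^n f_i(x)$ over $x\in\mathbb{R}^d$, with $f_i(x)=\frac1m\sum_{j=1}^mf_{ij}(x)$ and differentiable $f_{ij}:\mathbb{R}^d\to\mathbb{R}$; the minimizer $x^*$ of $f$ is unique. $f$ is $\mu$-quasi strongly convex ($\mu\ge0$) if $f(x^* )\ge f(x)+\langle\nabla f(x),x^*-x\rangle+\frac{\mu}{2}\|x-x^*\|^2$ for all $x$. $f$ is $L$-smooth if $\|\nabla f(x)-\nabla f(y)\|\le L\|x-y\|$ for all $x,y$. Stochastic reformulation: for each $i$, $\xi_i=(\xi_{i1},\dots,\xi_{im})^\top$ is a random vector with distribution $\mathcal{D}_i$ such that $\mathbb{E}[\xi_{ij}]=1$ for all $j$, and $f_{\xi_i}(x)=\frac1m\sum_{j=1}^m\xi_{ij}f_{ij}(x)$. Expected Smoothness assumption (constant $\mathcal{L}>0$): for all $x\in\mathbb{R}^d$ and all $i=1,\dots,n$, $$\mathbb{E}_{\xi_i\sim\mathcal{D}_i}\left[\|\nabla f_{\xi_i}(x)-\nabla f_{\xi_i}(x^* )\|^2\right]\le2\mathcal{L}\left(f_i(x)-f_i(x^* )-\langle\nabla f_i(x^* ),x-x^*\rangle\right).$$ Absolute compression operator: a (possibly stochastic) map $\mathcal{C}:\mathbb{R}^d\to\mathbb{R}^d$ for which there is $\Delta\ge0$ with $\mathbb{E}[\|\mathcal{C}(x)-x\|^2]\le\Delta^2$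 for all $x\in\mathbb{R}^d$. If $\mathcal{C}$ is stochastic, each application uses fresh randomness. EC-SGD: given $x^0\in\mathbb{R}^d$ and stepsize $\gamma>0$, set $e_i^0=0$ for $i=1,\dots,n$. For $k=0,1,2,\dots$, each worker $i$ computes a stochastic gradient $g_i^k$, sets $v_i^k=\gamma\,\mathcal{C}\!\left(\frac{e_i^k+\gamma g_i^k}{\gamma}\right)$ and $e_i^{k+1}=e_i^k+\gamma g_i^k-v_i^k$; then $x^{k+1}=x^k-v^k$ with $v^k=\frac1n\sum_{i=1}^n v_i^k$. EC-SGD-AS is EC-SGD with $g_i^k=\nabla f_{\xi_i^k}(x^k)$, where $\xi_i^k$ is sampled from $\mathcal{D}_i$ independently of previous steps and of the other workers. Order notation: $\mathcal{O}(\cdot)$ hides an absolute numerical constant. $\widetilde{\mathcal{O}}(\cdot)$ hides absolute numerical constants (including a positive absolute constant factor in the exponent) and factors polynomial in logarithms of $K$ and of the problem parameters.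
   Formalization: In the case μ=0 the bound is stated only for x^0 ≠ x^*: if R_0=0 the displayed bound is 0, but with σ_*>0 (e.g. exact communication, Δ=0) any γ>0 moves the iterates off x^* and gives a positive expected gap. *)

(* Defs.v *)
From HB Require Import structures.
From mathcomp Require Import all_boot all_order all_algebra.
From mathcomp Require Import all_classical all_reals all_analysis.

Set Implicit Arguments.
Unset Strict Implicit.
Unset Printing Implicit Defensive.

Import Order.TTheory GRing.Theory Num.Theory.
Import numFieldNormedType.Exports.

Local Open Scope classical_set_scope.
Local Open Scope ring_scope.

(* The library norm on 'rV[R]_d is the sup norm; it induces the same notion of
   differentiability, but the inequalities below need the Euclidean norm. *)
Section euclidean.
Context {R : realType} {d : nat}.
Implicit Types (u v x y : 'rV[R]_d) (f : 'rV[R]_d -> R).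

Definition dotp u v : R := \sum_(j < d) u 0 j * v 0 j.

Definition enorm u : R := Num.sqrt (dotp u u).

Definition gradient f x : 'rV[R]_d := \row_j 'd f x (delta_mx 0 j).

Definition unique_minimizer f x :=
  (forall y, f x <= f y) /\ (forall y, (forall z, f y <= f z) -> y = x).

Definition quasi_strongly_convex (mu : R) f xs :=
  forall x, f x + dotp (gradient f x) (xs - x) + mu / 2 * enorm (x - xs) ^+ 2
            <= f xs.

Definition smooth (L : R) f :=
  forall x y, enorm (gradient f x - gradient f y) <= L * enorm (x - y).

End euclidean.

Section finite_sum.
Context {R : realType} {d n m : nat}.
Variable fs : 'I_n -> 'I_m -> 'rV[R]_d -> R.

Definition local_loss (i : 'I_n) (x : 'rV[R]_d) : R :=
  m%:R^-1 * \sum_(j < m) fs i j x.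

Definition loss (x : 'rV[R]_d) : R := n%:R^-1 * \sum_(i < n) local_loss i x.

Definition stoch_loss (i : 'I_n) (xi : m.-tuple R) (x : 'rV[R]_d) : R :=
  m%:R^-1 * \sum_(j < m) tnth xi j * fs i j x.

Variable D : 'I_n -> probability (m.-tuple R) R.

(* Since 'E_P is an extended-real integral, this entails integrability. *)
Definition unit_mean := forall i j, ('E_(D i)[fun xi => tnth xi j] = 1)%E.

Definition expected_smoothness (calL : R) (xs : 'rV[R]_d) :=
  forall x i,
    ('E_(D i)[fun xi => (enorm (gradient (stoch_loss i xi) x
                               - gradient (stoch_loss i xi) xs) ^+ 2)%R]
     <= (2 * calL * (local_loss i x - local_loss i xs
                     - dotp (gradient (local_loss i) xs) (x - xs)))%:E)%E.

Definition sigma_star2 (xs : 'rV[R]_d) : \bar R :=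
  (n%:R^-1%:E * \sum_(i < n)
     'E_(D i)[fun xi => (enorm (gradient (stoch_loss i xi) xs
                               - gradient (local_loss i) xs) ^+ 2)%R])%E.

End finite_sum.

(* A stochastic operator on R^d is a map [C z] driven by a seed [z] of law [Q];
   a deterministic one is the case where [C] ignores its seed.  Joint
   measurability in (z, x) is for the product Borel sigma-algebra of R^d,
   which the library provides on d.-tuple R. *)
Section compression.
Context {R : realType} {d : nat} {dZ : measure_display} {Z : measurableType dZ}.

Definition measurable_operator (C : Z -> 'rV[R]_d -> 'rV[R]_d) :=
  forall j, measurable_fun [set: Z * d.-tuple R]
    (fun p => C p.1 (\row_i tnth p.2 i) 0 j).

Definition absolute_compression (Q : probability Z R)
    (C : Z -> 'rV[R]_d -> 'rV[R]_d) (Delta : R) :=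
  [/\ measurable_operator C, 0 <= Delta &
      forall x, ('E_Q[fun z => (enorm (C z x - x) ^+ 2)%R] <= (Delta ^+ 2)%:E)%E].

End compression.

Section algorithm.
Context {R : realType} {d n : nat}.

(* One realization of EC-SGD, given the maps [g k i] sending x^k to g_i^k and
   [c k i], the compression used by worker [i] at step [k].  The state is
   (x^k, (e_i^k)_i). *)
Fixpoint ec_sgd (gamma : R) (x0 : 'rV[R]_d)
    (g c : nat -> 'I_n -> 'rV[R]_d -> 'rV[R]_d) (k : nat) :
    'rV[R]_d * ('I_n -> 'rV[R]_d) :=
  if k is k'.+1 then
    let: (x, e) := ec_sgd gamma x0 g c k' in
    let v i := gamma *: c k' i (gamma^-1 *: (e i + gamma *: g k' i x)) in
    (x - n%:R^-1 *: \sum_(i < n) v i,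
     fun i => e i + gamma *: g k' i x - v i)
  else (x0, fun=> 0).

Definition averaging_rate (gamma mu : R) : R :=
  Num.min (gamma * mu / 2) (1 / 4).

Definition weight (eta : R) (k : nat) : R := (1 - eta) ^- k.+1.

Definition weighted_average (eta : R) (K : nat) (x : nat -> 'rV[R]_d) :=
  (\sum_(0 <= k < K.+1) weight eta k)^-1
    *: \sum_(0 <= k < K.+1) weight eta k *: x k.

End algorithm.

Section randomness.
Context {R : realType} {dO : measure_display} {Omega : measurableType dO}.
Variable P : probability Omega R.

Definition has_law {d1 : measure_display} {T : measurableType d1}
    (X : Omega -> T) (mu : set T -> \bar R) :=
  measurable_fun [set: Omega] X /\
  forall A, measurable A -> P (X @^-1` A) = mu A.

Definition mutually_independent {I : choiceType}
    (F : I -> set (set Omega)) :=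
  forall (J : seq I) (A : I -> set Omega), uniq J ->
    (forall j, j \in J -> F j (A j)) ->
    P (\bigcap_(j in [set` J]) A j) = (\prod_(j <- J) P (A j))%E.

Definition generated_events {d1 : measure_display} {T : measurableType d1}
    (X : Omega -> T) : set (set Omega) :=
  preimage_set_system [set: Omega] X measurable.

(* [xi k i] is the sampling vector and [zeta k i] the compression seed of
   worker [i] at step [k]. *)
Definition fresh_sampling {n m : nat} {dZ : measure_display}
    {Z : measurableType dZ} (D : 'I_n -> probability (m.-tuple R) R)
    (Q : probability Z R) (xi : nat -> 'I_n -> Omega -> m.-tuple R)
    (zeta : nat -> 'I_n -> Omega -> Z) :=
  [/\ forall k i, has_law (xi k i) (D i),
      forall k i, has_law (zeta k i) Q &
      mutually_independent (fun s : (nat * 'I_n) + (nat * 'I_n) =>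
        match s with
        | inl (k, i) => generated_events (xi k i)
        | inr (k, i) => generated_events (zeta k i)
        end)].

End randomness.

Definition ec_sgd_as {R : realType} {d n m : nat} {Z Omega : Type}
    (fs : 'I_n -> 'I_m -> 'rV[R]_d -> R) (C : Z -> 'rV[R]_d -> 'rV[R]_d)
    (gamma : R) (x0 : 'rV[R]_d) (xi : nat -> 'I_n -> Omega -> m.-tuple R)
    (zeta : nat -> 'I_n -> Omega -> Z) (k : nat) (w : Omega) : 'rV[R]_d :=
  (ec_sgd gamma x0 (fun k i => gradient (stoch_loss fs i (xi k i w)))
     (fun k i => C (zeta k i w)) k).1.

(* Since [ln] is 0 on nonpositive reals, a vanishing parameter adds nothing. *)
Definition log_size {R : realType} (s : seq R) : R :=
  1 + \sum_(a <- s) `|ln a|.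

(* Main.v *)
(** Subtracting the average error from the iterates gives virtual iterates that
    follow plain SGD with the averaged stochastic gradient. The error of a worker
    after a step is [gamma] times the error of one fresh compression, hence has
    second moment at most [gamma^2 Delta^2] whatever the past. Quasi-strong
    convexity, smoothness and the variance bound from expected smoothness then
    contract the squared distance of the virtual iterates to [xs], up to these
    noise terms, while releasing the current function gap; summing with the
    weights [w_k] and Jensen's inequality give, for every admissible [gamma],
      [E gap <= 2 R0^2 / (gamma W_K) + 20 L gamma^2 Delta^2 + 4 gamma sigma2 / n],
    and it remains to choose [gamma].

    All expectations are of nonnegative functions: the workers' samples are
    integrated out one at a time by Tonelli's theorem, which replaces the usual
    conditional expectations and the vanishing cross terms. *)

Require Import Defs.
From HB Require Import structures.
From mathcomp Require Import all_boot all_order all_algebra.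
From mathcomp Require Import ring lra.
From mathcomp Require Import all_classical all_reals all_analysis.
From mathcomp Require Import measurable_realfun.

Set Implicit Arguments.
Unset Strict Implicit.
Unset Printing Implicit Defensive.

Import Order.TTheory GRing.Theory Num.Theory.
Import numFieldNormedType.Exports.

Local Open Scope classical_set_scope.
Local Open Scope ring_scope.

(** * Euclidean geometry and smooth functions *)

Section euclidean_algebra.
Context {R : realType} {d : nat}.
Implicit Types (u v w : 'rV[R]_d) (a c : R).

(** The gain [1 / n] in the sampling noise comes from independence across workers, but no second
    moment of the iterates is known in advance, so cross terms cannot simply be expanded and
    discarded. Exact gradients are therefore replaced by sampled ones worker by worker. Each
    replacement adds [gamma / n%:R] times a deviation that is linear in the entries of [xi] minus 1,
    hence centered by the unit means alone, to a vector that ignores the sample in question; the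
    square of the sum then integrates to the sum of squares, infinite values allowed. That the
    expected squared distances and gaps are finite is read off the descent inequality afterwards, by
    induction on the step. To freeze everything but one seed, [Omega] is given the sigma-algebra
    generated by all the other seeds, on which the past is measurable. Compression errors of
    different workers are averaged by convexity only, so [Delta] gets no factor [1 / n]. *)

Lemma dotpC u v : dotp u v = dotp v u.
Proof. by apply: eq_bigr => j _; rewrite mulrC. Qed.

Lemma dotpDl u v w : dotp (u + v) w = dotp u w + dotp v w.
Proof. by rewrite -big_split; apply: eq_bigr => j _; rewrite mxE mulrDl. Qed.

Lemma dotpZl a u v : dotp (a *: u) v = a * dotp u v.
Proof. by rewrite /dotp mulr_sumr; apply: eq_bigr => j _; rewrite mxE mulrA. Qed.

Lemma dotpDr u v w : dotp u (v + w) = dotp u v + dotp u w.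
Proof. by rewrite dotpC dotpDl !(dotpC u). Qed.

Lemma dotpZr a u v : dotp u (a *: v) = a * dotp u v.
Proof. by rewrite dotpC dotpZl dotpC. Qed.

Lemma dotpNl u v : dotp (- u) v = - dotp u v.
Proof. by rewrite -scaleN1r dotpZl mulN1r. Qed.

Lemma dotpNr u v : dotp u (- v) = - dotp u v.
Proof. by rewrite dotpC dotpNl dotpC. Qed.

Lemma dotp0l v : dotp 0 v = 0.
Proof. by rewrite -(scale0r 0) dotpZl mul0r. Qed.

Lemma dotp0r v : dotp v 0 = 0.
Proof. by rewrite dotpC dotp0l. Qed.

Lemma dotp_suml (I : Type) (s : seq I) (P : pred I) (F : I -> 'rV[R]_d) v :
  dotp (\sum_(i <- s | P i) F i) v = \sum_(i <- s | P i) dotp (F i) v.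
Proof.
by elim/big_rec2: _ => [|i y z _ <-]; rewrite ?dotp0l// dotpDl.
Qed.

Lemma dotp_sumr (I : Type) (s : seq I) (P : pred I) (F : I -> 'rV[R]_d) v :
  dotp v (\sum_(i <- s | P i) F i) = \sum_(i <- s | P i) dotp v (F i).
Proof. by rewrite dotpC dotp_suml; under eq_bigr do rewrite dotpC. Qed.

Definition dotpE := (dotpDl, dotpDr, dotpNl, dotpNr, dotpZl, dotpZr).

Lemma dotp_ge0 u : 0 <= dotp u u.
Proof. by apply: sumr_ge0 => j _; rewrite -expr2 sqr_ge0. Qed.

Lemma dotp_eq0 u : dotp u u = 0 -> u = 0.
Proof.
move=> /eqP; rewrite psumr_eq0 => [/allP u0|j _]; last by rewrite -expr2 sqr_ge0.
apply/rowP => j; rewrite mxE.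
by have := u0 j (mem_index_enum _); rewrite -expr2 sqrf_eq0 => /eqP.
Qed.

Lemma enorm_sqr u : enorm u ^+ 2 = dotp u u.
Proof. by rewrite sqr_sqrtr// dotp_ge0. Qed.

Lemma enorm_ge0 u : 0 <= enorm u.
Proof. exact: sqrtr_ge0. Qed.

Lemma dotp_young c u v : 0 < c ->
  2 * dotp u v <= c * dotp u u + c^-1 * dotp v v.
Proof.
move=> c0; have := dotp_ge0 (c *: u - v); rewrite !dotpE (dotpC v) => h.
rewrite -(ler_pM2l c0) mulrDr mulVKf ?gt_eqF//; nra.
Qed.

Lemma dotp_sqrD u v : dotp (u + v) (u + v) <= 2 * dotp u u + 2 * dotp v v.
Proof.
by have := dotp_ge0 (u - v); rewrite !dotpE (dotpC v); lra.
Qed.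

(** Plays the role of Cauchy-Schwarz: Young's inequality with weight [c^-1] makes both terms at most
    [c * dotp v v]. For [c = 0] there is no such weight, but then [u = 0]. *)
Lemma dotp_le_enorm c u v : 0 <= c -> enorm u <= c * enorm v ->
  dotp u v <= c * dotp v v.
Proof.
rewrite le_eqVlt => /predU1P[<-|c0] uv.
  rewrite mul0r in uv; suff -> : u = 0; first by rewrite dotp0l mul0r.
  apply: dotp_eq0; rewrite -enorm_sqr.
  have /eqP -> : enorm u == 0 by rewrite eq_le uv enorm_ge0.
  by rewrite expr0n.
have : dotp u u <= c ^+ 2 * dotp v v.
  by rewrite -!enorm_sqr -exprMn ler_sqr// nnegrE ?enorm_ge0// mulr_ge0 ?enorm_ge0// ltW.
rewrite -(ler_pM2l (_ : 0 < c^-1)) ?invr_gt0// expr2 -mulrA mulKf ?gt_eqF// => h.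
by have := dotp_young u v (_ : 0 < c^-1); rewrite invrK invr_gt0 => /(_ c0); lra.
Qed.

(* With [e] the mean, sum [2 <e, f i> <= |e|^2 + |f i|^2] over [i]. *)
Lemma dotp_mean n (f : 'I_n -> 'rV[R]_d) : (0 < n)%N ->
  dotp (n%:R^-1 *: \sum_(i < n) f i) (n%:R^-1 *: \sum_(i < n) f i) <=
  n%:R^-1 * \sum_(i < n) dotp (f i) (f i).
Proof.
move=> n0; set e := _ *: _.
have n0R : (0 : R) < n%:R by rewrite ltr0n.
have esum : \sum_(i < n) f i = n%:R *: e.
  by rewrite scalerA divff ?scale1r// gt_eqF.
have : \sum_(i < n) 2 * dotp e (f i) <= \sum_(i < n) (dotp e e + dotp (f i) (f i)).
  by apply: ler_sum => i _; have := dotp_young e (f i) ltr01; rewrite invr1 !mul1r.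
rewrite big_split/= sumr_const card_ord -mulr_sumr -dotp_sumr esum dotpZr -mulr_natl => h.
by rewrite -(ler_pM2l n0R) mulVKf ?gt_eqF//; lra.
Qed.

End euclidean_algebra.

Section gradient_calculus.
Context {R : realType} {d : nat}.
Implicit Types (u v x y : 'rV[R]_d) (f : 'rV[R]_d -> R).

Lemma dotp_gradient f x v : dotp (gradient f x) v = 'd f x v.
Proof.
rewrite [in RHS](row_sum_delta v) raddf_sum; apply: eq_bigr => j _.
by rewrite /= linearZ mxE mulrC.
Qed.

Lemma is_diff_lincomb n (a : 'I_n -> R) (f : 'I_n -> 'rV[R]_d -> R) x :
  (forall i, differentiable (f i) x) ->
  is_diff x (fun y => \sum_(i < n) a i * f i y)
    (fun v => \sum_(i < n) a i * 'd (f i) x v).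
Proof.
move=> df.
have H (s : seq 'I_n) : is_diff x (fun y => \sum_(i <- s) a i * f i y)
    (fun v => \sum_(i <- s) a i * 'd (f i) x v).
  elim: s => [|i s IH].
    under eq_fun do rewrite big_nil.
    under [X in is_diff _ _ X]eq_fun do rewrite big_nil.
    exact: is_diff_cst.
  under eq_fun do rewrite big_cons.
  under [X in is_diff _ _ X]eq_fun do rewrite big_cons.
  apply: (@is_diffD _ _ _ (fun y => a i * f i y) _ (fun v => a i * 'd (f i) x v)) => //.
  by apply: (@is_diffZ _ _ _ (f i) ('d (f i) x)); apply: differentiableP.
exact: H.
Qed.

Lemma differentiable_lincomb n (a : 'I_n -> R) (f : 'I_n -> 'rV[R]_d -> R) x :
  (forall i, differentiable (f i) x) ->
  differentiable (fun y => \sum_(i < n) a i * f i y) x.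
Proof. by move=> df; have [] := is_diff_lincomb a df. Qed.

Lemma gradient_lincomb n (a : 'I_n -> R) (f : 'I_n -> 'rV[R]_d -> R) x :
  (forall i, differentiable (f i) x) ->
  gradient (fun y => \sum_(i < n) a i * f i y) x =
  \sum_(i < n) a i *: gradient (f i) x.
Proof.
move=> df; apply/rowP => j; rewrite mxE (@diff_val _ _ _ _ _ _ _ (is_diff_lincomb a df)).
by rewrite summxE; apply: eq_bigr => i _; rewrite !mxE.
Qed.

Lemma is_derive_line f x v (t : R) : differentiable f (x + t *: v) ->
  is_derive t 1 (fun s : R => f (x + s *: v)) (dotp (gradient f (x + t *: v)) v).
Proof.
move=> df; rewrite dotp_gradient.
have dg : is_diff t (fun s : R => x + s *: v) (fun s : R => s *: v).
  have -> : (fun s : R => x + s *: v) = cst x + ( *:%R^~ v) by [].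
  apply: (is_diff_eq (is_diffD (is_diff_cst x t) (is_diff_scalel t v))).
  by apply/funext => s; rewrite /= add0r.
have dfP : is_diff (x + t *: v) f ('d f (x + t *: v)) by exact: differentiableP.
have [hd he] := @is_diff_comp _ _ _ _ (fun s : R => x + s *: v) _ f _ t dg dfP.
apply: DeriveDef; first exact: diff_derivable.
by rewrite deriveE// he /= scale1r.
Qed.

Section smooth_functions.
Variables (L : R) (f : 'rV[R]_d -> R).
Hypotheses (L0 : 0 <= L) (df : forall x, differentiable f x) (sf : smooth L f).

(** By the mean value theorem on the segment, only [gradient f (x + t *: v) - gradient f x] tested
    against [v] remains, with [t <= 1]. Integrating along the segment would give [L / 2]; the factor
    lost reappears as [4 * L] instead of [2 * L] in [gradient_sqr_le]. *)
Lemma smooth_descent x v : f (x + v) <= f x + dotp (gradient f x) v + L * dotp v v.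
Proof.
have [||t] := @MVT_segment R (fun s => f (x + s *: v))
    (fun s => dotp (gradient f (x + s *: v)) v) 0 1 ler01.
- by move=> t _; exact: is_derive_line.
- apply: derivable_within_continuous => t _.
  by have [] := is_derive_line (df (x + t *: v)).
rewrite in_itv/= => /andP[t0 t1]; rewrite scale1r scale0r addr0 subr0 mulr1 => E.
rewrite -lerBlDl opprD addrA E -dotpNl -dotpDl.
apply: dotp_le_enorm => //; apply: le_trans (sf _ _) _.
rewrite addrC addKr ler_wpM2l// -ler_sqr ?nnegrE ?enorm_ge0//.
rewrite !enorm_sqr dotpZl dotpZr mulrA ler_piMl ?dotp_ge0//.
by rewrite -expr2 exprn_ile1.
Qed.

Variable xs : 'rV[R]_d.
Hypothesis fmin : forall y, f xs <= f y.

(** A move from [x] along [- t *: g] cannot go below the minimum; the resulting bound is best at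
    [t = (2 * L)^-1]. *)
Lemma gradient_sqr_le x :
  dotp (gradient f x) (gradient f x) <= 4 * L * (f x - f xs).
Proof.
set g := gradient f x.
have key t : t * dotp g g - L * t ^+ 2 * dotp g g <= f x - f xs.
  have := le_trans (fmin _) (smooth_descent x (- t *: g)).
  rewrite !dotpE -/g => h.
  have -> : t * dotp g g - L * t ^+ 2 * dotp g g =
      t * dotp g g - L * (t * t * dotp g g) by ring.
  lra.
(* For [L = 0] every [t] is allowed; if [g] were nonzero, [t = (f x - f xs + 1) / dotp g g] would
   give [f x - f xs + 1 <= f x - f xs]. *)
have [L0'|Ln0] := eqVneq L 0.
  rewrite L0' mulr0 mul0r leNgt; apply/negP => gg.
  have := key ((f x - f xs + 1) / dotp g g).
  by rewrite L0' !mul0r subr0 divfK ?gt_eqF//; lra.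
have Lp : 0 < L by rewrite lt_neqAle eq_sym Ln0.
have := key (2 * L)^-1.
have -> : (2 * L)^-1 * dotp g g - L * (2 * L)^-1 ^+ 2 * dotp g g = (4 * L)^-1 * dotp g g.
  by field.
by rewrite mulrC ler_pdivrMr ?mulr_gt0// [_ * (4 * L)]mulrC.
Qed.

Lemma gradient_minimizer : gradient f xs = 0.
Proof.
apply: dotp_eq0; apply/eqP; rewrite eq_le dotp_ge0 andbT.
by have := gradient_sqr_le xs; rewrite subrr mulr0.
Qed.

(** Quasi-strong convexity at [xs + u] and minimality give [mu / 2 * dotp u u <= dotp g u] for the
    gradient [g] there, and [g] is within [L * enorm u] of the zero gradient at [xs]. The factor
    [dotp u u] is kept because in dimension 0 nothing bounds [mu]. *)
Lemma quasi_strong_convexity_le_smoothness mu : quasi_strongly_convex mu f xs ->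
  forall u, mu * dotp u u <= 2 * L * dotp u u.
Proof.
move=> qsc u; have := qsc (xs + u); rewrite enorm_sqr [xs + u - xs]addrC addKr.
have -> : xs - (xs + u) = - u by rewrite opprD addrA subrr add0r.
rewrite dotpNr => h.
have : dotp (gradient f (xs + u)) u <= L * dotp u u.
  apply: dotp_le_enorm => //; have := sf (xs + u) xs.
  by rewrite gradient_minimizer subr0 [xs + u - xs]addrC addKr.
by have := fmin (xs + u); lra.
Qed.

End smooth_functions.
End gradient_calculus.

(** * Measurability in R^d *)

Section row_measurability.
Context {R : realType} {d : nat} {dT : measure_display} {T : measurableType dT}.
Implicit Types (X Y : T -> 'rV[R]_d).

Definition measurable_row X := forall j, measurable_fun [set: T] (fun w => X w 0 j).

(* Evaluating [f] at the grid point below [X] takes countably many values;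
   refining the grid gives [f (X w)] in the limit. *)
Lemma measurable_continuous_row (f : 'rV[R]_d -> R) X :
  continuous f -> measurable_row X -> measurable_fun [set: T] (f \o X).
Proof.
move=> cf mX.
pose cell (N : nat) (w : T) : {ffun 'I_d -> int} :=
  [ffun j => Num.floor (N.+1%:R * X w 0 j)].
pose grid (N : nat) (z : {ffun 'I_d -> int}) : 'rV[R]_d :=
  \row_j (N.+1%:R^-1 * (z j)%:~R).
apply: (@measurable_fun_cvg _ _ _ _ (fun N w => f (grid N (cell N w)))).
  (* The preimage of [B] is the union of the cells whose grid point [f] sends into [B]: countably
     many, each cut out by half-open intervals on the coordinates. *)
  move=> N _ B mB; rewrite setTI.
  rewrite [X in measurable X](_ : _ = \bigcup_z
     (if asbool (B (f (grid N z))) then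
        \bigcap_j
          ((fun w => N.+1%:R * X w 0 j) @^-1` `[(z j)%:~R, (z j + 1)%:~R[)
      else set0)); last first.
    apply/seteqP; split => [w/= Bw|w/= [z _]].
      exists (cell N w) => //; rewrite asboolT//.
      by move=> j _ /=; rewrite in_itv/= ffunE floor_itv.
    case: asboolP => // Bz wz.
    suff -> : cell N w = z by [].
    apply/ffunP => j; rewrite ffunE; apply: floor_def.
    by have /= := wz j Logic.I; rewrite in_itv.
  apply: countable_bigcupT_measurable; first exact: countableP.
  move=> z; case: ifP => // _; apply: fin_bigcap_measurable => [|j _].
    exact: finite_finset.
  rewrite -[X in measurable X]setTI.
  by apply: (measurable_funM (measurable_cst _) (mX j)).
move=> w _; apply: continuous_cvg; first exact: cf.
apply/cvg_ballP => e e0.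
have [N0 _ HN0] : \forall N \near \oo, (N.+1%:R^-1 : R) < e.
  have /cvgrPdist_lt/(_ e e0) := @cvg_harmonic R.
  apply: filterS => N; rewrite sub0r normrN.
  by apply: le_lt_trans; exact: ler_norm.
near=> N; split => // i j; rewrite (ord1 i) !mxE /ball/= ffunE.
have N1 : (0 : R) < N.+1%:R by rewrite ltr0n.
have /andP[fl fu] := floor_itv (N.+1%:R * X w 0 j).
have -> : X w 0 j - N.+1%:R^-1 * (Num.floor (N.+1%:R * X w 0 j))%:~R =
   N.+1%:R^-1 * (N.+1%:R * X w 0 j - (Num.floor (N.+1%:R * X w 0 j))%:~R).
  by rewrite mulrBr mulKf// gt_eqF.
rewrite ger0_norm ?mulr_ge0 ?invr_ge0 ?subr_ge0 ?(ltW N1)//.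
apply: (@le_lt_trans _ _ N.+1%:R^-1).
  by rewrite ler_piMr ?invr_ge0 ?(ltW N1)// lerBlDl; move: fu; rewrite intrD => /ltW.
by apply: HN0; near: N; exists N0.
Unshelve. all: by end_near. Qed.

Lemma measurable_row_cst (x : 'rV[R]_d) : measurable_row (cst x).
Proof. by move=> j; exact: measurable_cst. Qed.

Lemma measurable_rowD X Y : measurable_row X -> measurable_row Y ->
  measurable_row (fun w => X w + Y w).
Proof.
move=> mX mY j; under eq_fun do rewrite mxE; exact: measurable_funD.
Qed.

Lemma measurable_rowZ (a : T -> R) X : measurable_fun [set: T] a ->
  measurable_row X -> measurable_row (fun w => a w *: X w).
Proof.
move=> ma mX j; under eq_fun do rewrite mxE; exact: measurable_funM.
Qed.

Lemma measurable_rowB X Y : measurable_row X -> measurable_row Y ->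
  measurable_row (fun w => X w - Y w).
Proof.
move=> mX mY j; under eq_fun do rewrite !mxE; exact: measurable_funB.
Qed.

Lemma measurable_row_sum (I : Type) (s : seq I) (X : I -> T -> 'rV[R]_d) :
  (forall i, measurable_row (X i)) ->
  measurable_row (fun w => \sum_(i <- s) X i w).
Proof.
move=> mX j; under eq_fun do rewrite summxE.
by apply: (@measurable_sum _ _ _ _ _ _ (fun i w => X i w 0 j)) => i; exact: mX.
Qed.

Lemma measurable_dotp X Y : measurable_row X -> measurable_row Y ->
  measurable_fun [set: T] (fun w => dotp (X w) (Y w)).
Proof. by move=> mX mY; apply: measurable_sum => j; exact: measurable_funM. Qed.

Lemma measurable_row_tuple X : measurable_row X ->
  measurable_fun [set: T] (fun w => [tuple X w 0 j | j < d]).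
Proof.
move=> mX; apply/measurable_fun_tnthP => j.
rewrite (_ : _ \o _ = fun w => X w 0 j); first exact: mX.
by apply/funext => w /=; rewrite tnth_mktuple.
Qed.

(** The gradient need not be continuous, but each partial derivative is the pointwise limit of
    difference quotients of the continuous [f] along a null sequence of increments. *)
Lemma measurable_gradient (f : 'rV[R]_d -> R) X :
  (forall x, differentiable f x) -> measurable_row X ->
  measurable_row (fun w => gradient f (X w)).
Proof.
move=> df mX j; have cf : continuous f.
  by move=> x; exact: differentiable_continuous.
pose e : 'rV[R]_d := delta_mx 0 j.
apply: (@measurable_fun_cvg _ _ _ _
  (fun N w => N.+1%:R * (f (N.+1%:R^-1 *: e + X w) - f (X w)))).
  move=> N; apply: measurable_funM => //; apply: measurable_funB.
    apply: (measurable_continuous_row cf); apply: measurable_rowD => //.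
  exact: measurable_continuous_row.
move=> w _; rewrite mxE -deriveE//.
have /cvg_ex[l Hl] := @diff_derivable _ _ _ f (X w) e (df (X w)).
have -> : 'D_e f (X w) = l by apply/cvg_lim.
rewrite [X in X @ _ --> _](_ : _ = fun N : nat => (N.+1%:R^-1)^-1 *:
    ((f \o shift (X w)) (N.+1%:R^-1 *: e) - f (X w))); last first.
  by apply/funext => N /=; rewrite invrK.
have /cvgr_dnbhsP/(_ (fun N => N.+1%:R^-1)) := Hl.
apply; split; last exact: cvg_harmonic.
by move=> N; rewrite invr_eq0 pnatr_eq0.
Qed.

End row_measurability.

(** * Independence *)

Section freezing.
Context {R : realType} {dO : measure_display} {Omega : measurableType dO}.
Variable P : probability Omega R.
Local Open Scope ereal_scope.

(* Conditioning on [X] freezes it when [Y] is independent of [X]: the joint law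
   is the product law, so this is Tonelli's theorem. *)
Lemma freezing d1 d2 (T1 : measurableType d1) (T2 : measurableType d2)
    (X : Omega -> T1) (Y : Omega -> T2) (nu : probability T2 R)
    (f : T1 * T2 -> \bar R) :
  measurable_fun setT X -> measurable_fun setT Y ->
  (forall A B, measurable A -> measurable B ->
    P (X @^-1` A `&` Y @^-1` B) = P (X @^-1` A) * nu B) ->
  measurable_fun setT f -> (forall p, 0 <= f p) ->
  \int[P]_w f (X w, Y w) = \int[P]_w \int[nu]_y f (X w, y).
Proof.
move=> mX mY XY mf f0.
pose XM := isMeasurableFun.Build _ _ _ _ _ mX.
pose X' : {mfun Omega >-> T1} := HB.pack X XM.
have mXY : measurable_fun setT (fun w => (X w, Y w)) by exact: measurable_fun_pair.
pose ZM := isMeasurableFun.Build _ _ _ _ _ mXY.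
pose Z' : {mfun Omega >-> (T1 * T2)%type} := HB.pack (fun w => (X w, Y w)) ZM.
transitivity (\int[distribution P Z']_p f p).
  by rewrite /distribution ge0_integral_pushforward// preimage_setT.
transitivity (\int[distribution P X' \x nu]_p f p).
  apply: eq_measure_integral => A mA _; apply/esym.
  exact: product_measure_unique.
rewrite fubini_tonelli1// /distribution ge0_integral_pushforward ?preimage_setT//.
  exact: measurable_fun_fubini_tonelli_F.
by move=> x _; apply: integral_ge0 => y _.
Qed.

(** [mutually_independent] only speaks of finitely many events. Finite intersections of events with
    indices other than [s] form a pi-system generating the sigma-algebra of the others, and the
    events satisfying the product rule with [B] form a Dynkin system containing it. *)
Lemma independent_of_others (I : choiceType) (F : I -> set (set Omega)) (s : I)
    (A B : set Omega) :
  (forall t, F t setT) -> (forall t, setI_closed (F t)) ->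
  (forall t C, F t C -> measurable C) -> mutually_independent P F ->
  <<s \bigcup_(t in [set t | t != s]) F t >> A -> F s B ->
  P (A `&` B) = P A * P B.
Proof.
move=> FT FI Fm indep.
pose pi_sys := [set C | exists J : seq I, exists f : I -> set Omega,
  [/\ uniq J, s \notin J, forall j, j \in J -> F j (f j) &
    C = \bigcap_(j in [set` J]) f j]].
have pi_sysI : setI_closed pi_sys.
  move=> _ _ [J1 [f1 [u1 s1 F1 ->]]] [J2 [f2 [u2 s2 F2 ->]]].
  (* An index listed on one side only is padded with [setT] on the other. *)
  exists (undup (J1 ++ J2)); exists (fun j => (if j \in J1 then f1 j else setT) `&`
    (if j \in J2 then f2 j else setT)); split.
  - exact: undup_uniq.
  - by rewrite mem_undup mem_cat negb_or s1 s2.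
  - move=> j _; apply: FI; case: ifPn => // ?; [exact: F1|exact: F2].
  - apply/seteqP; split => [w [w1 w2] j _|w ww].
      by split; case: ifPn => // jJ; [exact: w1|exact: w2].
    by split => j /= jJ; have := ww j; rewrite /= mem_undup mem_cat jJ ?orbT => /(_ isT) [].
have pi_sysm C : pi_sys C -> measurable C.
  move=> [J [f [_ _ Ff ->]]]; rewrite bigcap_seq big_seq.
  by apply: bigsetI_measurable => j jJ; exact/(Fm j)/Ff.
move=> sA FB; have mB := Fm _ _ FB.
suff [] : [set C | measurable C /\ P (C `&` B) = P C * P B] A by [].
move: A sA; apply: (@subset_trans _ <<s pi_sys >>).
  apply: sub_smallest2r; first exact: smallest_sigma_algebra.
  move=> C [t /= ts FC]; exists [:: t]; exists (fun=> C).
  split => //; first by rewrite inE eq_sym.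
  - by move=> j; rewrite inE => /eqP ->.
  - by rewrite bigcap_seq big_seq1.
apply: lambda_system_subset => //; last first.
  move=> C piC; split; first exact: pi_sysm.
  have [J [f [uJ sJ Ff ->]]] := piC.
  (* Placing [B] at the absent index [s] turns the product rule into independence over [s :: J]. *)
  pose f' j := if j == s then B else f j.
  have sJj j : j \in J -> (j == s) = false.
    by move=> jJ; apply/negbTE; apply: contraNneq sJ => <-.
  have ff' : \bigcap_(j in [set` J]) f j = \bigcap_(j in [set` J]) f' j.
    by apply: eq_bigcapr => j /= jJ; rewrite /f' sJj.
  have f'F j : j \in s :: J -> F j (f' j).
    rewrite inE /f'; case: eqVneq => [->//|_ /= jJ]; exact: Ff.
  rewrite {1}ff'; have -> : \bigcap_(j in [set` J]) f' j `&` B =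
      \bigcap_(j in [set` s :: J]) f' j.
    rewrite !bigcap_seq big_cons setIC; congr (_ `&` _).
    by rewrite /f' eqxx.
  rewrite indep//=; last by rewrite sJ.
  rewrite big_cons {1}/f' eqxx muleC; congr (_ * _).
  rewrite ff' indep// => j jJ; apply: f'F.
  by rewrite inE jJ orbT.
apply/dynkin_lambda_system; split.
- by split => //=; rewrite setTI probability_setT mul1e.
- move=> C [mC CB]; split; first exact: measurableC.
  have -> : P (~` C `&` B) = P B - P (C `&` B).
    by rewrite setIC -setDE measureD ?ltey_eq ?fin_num_measure// [B `&` C]setIC.
  rewrite CB probability_setC// muleBl ?fin_num_measure ?mul1e//.
- move=> C tC HC; have mC k : measurable (C k) by have [] := HC k.
  split; first exact: bigcup_measurable.
  rewrite setI_bigcupl !measure_bigcup//=.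
  + rewrite muleC -(fineK (fin_num_measure P B mB)) -nneseriesZl//.
    by apply: eq_eseriesr => k _; have [_ ->] := HC k; rewrite fineK ?fin_num_measure// muleC.
  + by move=> k _; exact: measurableI.
  + by apply: trivIset_setIr.
Qed.
End freezing.

Section fresh_seeds.
Context {R : realType} {n m : nat} {dZ dO : measure_display}.
Context {Z : measurableType dZ} {Omega : measurableType dO}.
Variables (P : probability Omega R) (D : 'I_n -> probability (m.-tuple R) R).
Variables (Q : probability Z R).
Variables (xi : nat -> 'I_n -> Omega -> m.-tuple R) (zeta : nat -> 'I_n -> Omega -> Z).
Hypothesis fresh : fresh_sampling P D Q xi zeta.

(** The family inside [fresh_sampling] under a name; the two are convertible, so the independence in
    [fresh] applies to it directly. *)
Definition seed_events (s : (nat * 'I_n) + (nat * 'I_n)) : set (set Omega) :=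
  match s with
  | inl (k, i) => generated_events (xi k i)
  | inr (k, i) => generated_events (zeta k i)
  end.

(* [Omega] with only the events generated by the seeds other than [s]. *)
Definition other_seeds s : Type :=
  g_sigma_algebraType (\bigcup_(t in [set t | t != s]) seed_events t).
HB.instance Definition _ s := Measurable.on (other_seeds s).

Lemma generated_events_setT d1 (T : measurableType d1) (X : Omega -> T) :
  generated_events X setT.
Proof. by exists setT => //; rewrite setTI preimage_setT. Qed.

Lemma generated_events_setI d1 (T : measurableType d1) (X : Omega -> T) :
  setI_closed (generated_events X).
Proof.
move=> _ _ [A mA <-] [B mB <-]; exists (A `&` B); first exact: measurableI.
by rewrite !setTI preimage_setI.
Qed.

Lemma seed_events_measurable s A : seed_events s A -> measurable A.
Proof.
have [fxi fzeta _] := fresh.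
case: s => [[k i]|[k i]] [B mB <-].
- by have [mx _] := fxi k i; exact: mx.
- by have [mz _] := fzeta k i; exact: mz.
Qed.

Lemma measurable_other_xi s k i : inl (k, i) != s ->
  measurable_fun [set: other_seeds s] (xi k i : other_seeds s -> _).
Proof.
move=> ts _ B mB; apply: sub_sigma_algebra.
by exists (inl (k, i)) => //; exists B.
Qed.

Lemma measurable_other_zeta s k i : inr (k, i) != s ->
  measurable_fun [set: other_seeds s] (zeta k i : other_seeds s -> _).
Proof.
move=> ts _ B mB; apply: sub_sigma_algebra.
by exists (inr (k, i)) => //; exists B.
Qed.

Lemma measurable_of_others s d1 (T : measurableType d1) (X : Omega -> T) :
  measurable_fun [set: other_seeds s] (X : other_seeds s -> T) ->
  measurable_fun [set: Omega] X.
Proof.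
move=> mX _ B mB; have := mX measurableT B mB.
apply: smallest_sub; first exact: sigma_algebra_measurable.
by move=> A [t _]; exact: seed_events_measurable.
Qed.

(** This is [freezing] with [X] the identity from [Omega] to [other_seeds s]: all other seeds are
    frozen together, however [f] depends on them. *)
Lemma freezing_seed s d1 (T : measurableType d1) (Y : Omega -> T)
    (nu : probability T R) (f : other_seeds s * T -> \bar R) :
  seed_events s = generated_events Y -> has_law P Y nu ->
  measurable_fun [set: other_seeds s * T] f -> (forall p, 0 <= f p)%E ->
  (\int[P]_w f (w, Y w) = \int[P]_w \int[nu]_y f (w, y))%E.
Proof.
move=> sY [mY lawY] mf f0; have [_ _ indep] := fresh.
apply: (@freezing _ _ _ P _ _ _ _ (fun w => w : other_seeds s)) => //.
  exact: measurable_of_others.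
move=> A B mA mB; rewrite -lawY//.
apply: (@independent_of_others _ _ _ P _ seed_events s) => //.
- by case=> [[k i]|[k i]]; exact: generated_events_setT.
- by case=> [[k i]|[k i]]; exact: generated_events_setI.
- exact: seed_events_measurable.
- by rewrite sY; exists B => //; rewrite setTI.
Qed.

Lemma freezing_seed_le s d1 (T : measurableType d1) (Y : Omega -> T)
    (nu : probability T R) (f : other_seeds s * T -> \bar R) (g : Omega -> \bar R) :
  seed_events s = generated_events Y -> has_law P Y nu ->
  measurable_fun [set: other_seeds s * T] f -> (forall p, 0 <= f p)%E ->
  measurable_fun [set: Omega] g ->
  (forall w, \int[nu]_y f (w, y) <= g w)%E ->
  (\int[P]_w f (w, Y w) <= \int[P]_w g w)%E.
Proof.
move=> sY lawY mf f0 mg fg; rewrite (freezing_seed sY lawY mf f0).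
apply: ge0_le_integral => //.
- by move=> w _; apply: integral_ge0.
- by apply: (@measurable_of_others s); exact: measurable_fun_fubini_tonelli_F.
Qed.

End fresh_seeds.

(** * Variance of a sampled gradient *)

Section centered_perturbation.
Context {R : realType} {dT : measure_display} {T : measurableType dT}.
Variable mu : probability T R.
Local Open Scope ereal_scope.

Lemma ge0_integralD_EFin (q r : T -> R) :
  measurable_fun setT q -> measurable_fun setT r ->
  (forall t, 0 <= q t)%R -> (forall t, 0 <= r t)%R ->
  \int[mu]_t (q t + r t)%:E = \int[mu]_t (q t)%:E + \int[mu]_t (r t)%:E.
Proof.
move=> mq mr q0 r0; under eq_integral do rewrite EFinD.
rewrite ge0_integralD//; do ?[exact/measurable_EFinP].
- by move=> t _; rewrite lee_fin.
- by move=> t _; rewrite lee_fin.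
Qed.

(* Adding [|l|] to both sides keeps every integrand nonnegative, so that [q] and
   [r] themselves need not be integrable. *)
Lemma ge0_integral_centered (q r l : T -> R) :
  measurable_fun setT q -> measurable_fun setT r ->
  (forall t, 0 <= q t)%R -> (forall t, 0 <= r t)%R ->
  mu.-integrable setT (EFin \o l) -> \int[mu]_t (l t)%:E = 0 ->
  (forall t, q t = r t + l t)%R ->
  \int[mu]_t (q t)%:E = \int[mu]_t (r t)%:E.
Proof.
move=> mq mr q0 r0 il l0 qrl.
have ml : measurable_fun setT l by apply/measurable_EFinP; case/integrableP: il.
have ial : mu.-integrable setT (fun t => `|l t|%:E).
  exact: (integrable_abse il).
have al_fin : \int[mu]_t (`|l t|)%:E \is a fin_num by exact: integrable_fin_num.
have : \int[mu]_t (q t + `|l t|)%:E = \int[mu]_t (r t + (`|l t| + l t))%:E.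
  by apply: eq_integral => t _; rewrite qrl; congr EFin; ring.
have mal : measurable_fun setT (fun t => `|l t|%R) by exact: measurableT_comp.
have all0 t : (0 <= `|l t| + l t)%R by rewrite -lerBlDr sub0r -normrN ler_norm.
rewrite (ge0_integralD_EFin mq mal)// (ge0_integralD_EFin mr (measurable_funD mal ml))//.
under [X in _ = _ + X -> _]eq_integral do rewrite EFinD.
rewrite [X in _ = _ + X -> _]integralD//= l0 adde0.
by move=> /(congr1 (fun x => x - \int[mu]_t (`|l t|)%:E)); rewrite !addeK.
Qed.

Lemma ge0_integralZ_EFin (c : R) (q : T -> R) : (0 <= c)%R ->
  measurable_fun setT q -> (forall t, 0 <= q t)%R ->
  \int[mu]_t (c * q t)%:E = c%:E * \int[mu]_t (q t)%:E.
Proof.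
move=> c0 mq q0; under eq_integral do rewrite EFinM.
rewrite ge0_integralZl_EFin//; last exact/measurable_EFinP.
by move=> t _; rewrite lee_fin.
Qed.

Lemma le_integral_EFin (q r : T -> R) :
  measurable_fun setT q -> measurable_fun setT r ->
  (forall t, 0 <= q t)%R -> (forall t, q t <= r t)%R ->
  \int[mu]_t (q t)%:E <= \int[mu]_t (r t)%:E.
Proof.
move=> mq mr q0 qr; apply: ge0_le_integral => //.
- by move=> t _; rewrite lee_fin.
- exact/measurable_EFinP.
- exact/measurable_EFinP.
- by move=> t _; rewrite lee_fin.
Qed.

Lemma integral_cst_EFin (c : R) : \int[mu]_t (cst c%:E) t = c%:E.
Proof. by rewrite integral_cst// [X in _ * X]probability_setT mule1. Qed.

End centered_perturbation.

Section random_combination.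
Context {R : realType} {d m : nat}.
Variable mu : probability (m.-tuple R) R.
Hypothesis mean1 : forall j, ('E_mu[fun t => tnth t j] = 1)%E.
Implicit Types (c : 'I_m -> 'rV[R]_d) (a b : 'rV[R]_d).
Local Open Scope ereal_scope.

(** With [c j] the gradient of [fs i j] divided by [m], this is the stochastic gradient for the
    sampling vector [t], and [rcomb_dev] is its deviation from the local gradient. *)
Definition rcomb c (t : m.-tuple R) : 'rV[R]_d := \sum_j tnth t j *: c j.

Definition rcomb_dev c (t : m.-tuple R) : 'rV[R]_d := rcomb c t - \sum_j c j.

(** The expectation is the integral of the positive part minus that of the negative part. A
    difference equal to 1 leaves neither infinite, since infinity minus infinity counts as [-oo]. *)
Lemma integrable_tnth j : mu.-integrable setT (fun t => (tnth t j)%:E).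
Proof.
apply/integrableP; split; first by apply/measurable_EFinP; exact: (@measurable_tnth _ _ m j).
have := mean1 j; rewrite unlock integralE => h.
have mt : measurable_fun setT (fun t : m.-tuple R => (tnth t j)%:E).
  by apply/measurable_EFinP; exact: (@measurable_tnth _ _ m j).
rewrite (_ : (fun x => _) = (fun t : m.-tuple R => (tnth t j)%:E)^\+ \+
   (fun t : m.-tuple R => (tnth t j)%:E)^\-); last first.
  by rewrite -fune_abse.
rewrite ge0_integralD//; [|exact: measurable_funepos|exact: measurable_funeneg].
move: h; set p := \int[_]_(_ in _) _; set q := \int[_]_(_ in _) _.
have p0 : 0 <= p by apply: integral_ge0.
have q0 : 0 <= q by apply: integral_ge0.
by case: p p0 => [p| |]//; case: q q0 => [q| |]//=; rewrite ltry.
Qed.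

Lemma rcomb_dev_sum c t : rcomb_dev c t = (\sum_j (tnth t j - 1) *: c j)%R.
Proof.
by rewrite /rcomb_dev /rcomb -sumrB; apply: eq_bigr => j _; rewrite scalerBl scale1r.
Qed.

Lemma dotp_rcomb_dev a c t :
  dotp a (rcomb_dev c t) = (\sum_j dotp a (c j) * (tnth t j - 1))%R.
Proof.
rewrite rcomb_dev_sum dotp_sumr; apply: eq_bigr => j _.
by rewrite dotpZr mulrC.
Qed.

Lemma rcomb_dev_centered a c :
  mu.-integrable setT (fun t => (dotp a (rcomb_dev c t))%:E) /\
  \int[mu]_t (dotp a (rcomb_dev c t))%:E = 0.
Proof.
have i1 j : mu.-integrable setT (fun t => (tnth t j - 1)%:E).
  under eq_fun do rewrite EFinB.
  apply: integrableB => //; first exact: integrable_tnth.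
  exact: finite_measure_integrable_cst.
have i2 j : mu.-integrable setT (fun t => (dotp a (c j))%:E * (tnth t j - 1)%:E).
  exact: integrableZl.
have E t : (dotp a (rcomb_dev c t))%:E =
    \sum_(j < m) (dotp a (c j))%:E * (tnth t j - 1)%:E.
  by rewrite dotp_rcomb_dev -sumEFin.
split; first by under eq_fun do rewrite E; exact: integrable_sum.
under eq_integral do rewrite E.
rewrite integral_sum// big1// => j _.
rewrite integralZl//; under eq_integral do rewrite EFinB.
rewrite integralB//; [|exact: integrable_tnth|exact: finite_measure_integrable_cst].
have := mean1 j; rewrite unlock => ->.
by rewrite integral_cst_EFin subee// mule0.
Qed.

Lemma measurable_rcomb c : measurable_row (rcomb c).
Proof.
apply: measurable_row_sum => j; apply: measurable_rowZ.
  exact: measurable_tnth.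
exact: measurable_row_cst.
Qed.

Lemma measurable_rcomb_dev c : measurable_row (rcomb_dev c).
Proof.
apply: measurable_rowB; first exact: measurable_rcomb.
exact: measurable_row_cst.
Qed.

(** Pythagoras: the cross term is integrable with mean 0. Infinite variance is allowed, so no square
    integrability has to be checked beforehand. *)
Lemma integral_sqr_rcomb b s c :
  \int[mu]_t (dotp (b + s *: rcomb_dev c t) (b + s *: rcomb_dev c t))%:E =
  (dotp b b)%:E + (s ^+ 2)%:E *
    \int[mu]_t (dotp (rcomb_dev c t) (rcomb_dev c t))%:E.
Proof.
have mdev := measurable_dotp (measurable_rcomb_dev c) (measurable_rcomb_dev c).
have [il l0] := rcomb_dev_centered (2 * s *: b)%R c.
rewrite (@ge0_integral_centered _ _ _ mu _
   (fun t => dotp b b + s ^+ 2 * dotp (rcomb_dev c t) (rcomb_dev c t))%R _ _ _ _ _ il l0).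
- rewrite ge0_integralD_EFin//.
  + rewrite [X in X + _]integral_cst_EFin ge0_integralZ_EFin// ?sqr_ge0// => t.
    exact: dotp_ge0.
  + exact: measurable_funM.
  + by move=> t; exact: dotp_ge0.
  + by move=> t; rewrite mulr_ge0 ?sqr_ge0 ?dotp_ge0.
- have mb : measurable_row (fun t => b + s *: rcomb_dev c t)%R.
    apply: measurable_rowD; first exact: measurable_row_cst.
    by apply: measurable_rowZ => //; exact: measurable_rcomb_dev.
  exact: measurable_dotp.
- by apply: measurable_funD => //; exact: measurable_funM.
- by move=> t; exact: dotp_ge0.
- move=> t; apply: addr_ge0; first exact: dotp_ge0.
  by rewrite mulr_ge0 ?sqr_ge0 ?dotp_ge0.
- by move=> t; move: (rcomb_dev c t) => v; rewrite !dotpE (dotpC v b); ring.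
Qed.

Lemma integral_sqr_rcomb_dev_le c :
  \int[mu]_t (dotp (rcomb_dev c t) (rcomb_dev c t))%:E <=
  \int[mu]_t (dotp (rcomb c t) (rcomb c t))%:E.
Proof.
have E t : rcomb c t = ((\sum_j c j) + 1 *: rcomb_dev c t)%R.
  by rewrite scale1r addrC subrK.
under [X in _ <= X]eq_integral do rewrite E.
by rewrite integral_sqr_rcomb expr1n mul1e leeDr// lee_fin dotp_ge0.
Qed.

(** Deviations are additive in [c]: split [c] into [c - c'] and [c'], and bound the variance of the
    difference by its second moment. For gradients at [x] and [xs], the first term is the left side
    of expected smoothness and the second is the noise at the optimum. *)
Lemma integral_sqr_rcomb_dev_split c c' :
  \int[mu]_t (dotp (rcomb_dev c t) (rcomb_dev c t))%:E <=
  2%:E * \int[mu]_t (dotp (rcomb c t - rcomb c' t) (rcomb c t - rcomb c' t))%:E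
  + 2%:E * \int[mu]_t (dotp (rcomb_dev c' t) (rcomb_dev c' t))%:E.
Proof.
pose b j := (c j - c' j)%R.
have Eb t : (rcomb c t - rcomb c' t = rcomb b t)%R.
  by rewrite /rcomb -sumrB; apply: eq_bigr => j _; rewrite scalerBr.
have Ec t : (rcomb_dev c t = rcomb_dev b t + rcomb_dev c' t)%R.
  by rewrite !rcomb_dev_sum -big_split; apply: eq_bigr => j _; rewrite /= -scalerDr subrK.
under [X in _ <= _ * X + _]eq_integral do rewrite Eb.
have md e := measurable_dotp (measurable_rcomb_dev e) (measurable_rcomb_dev e).
apply: (@le_trans _ _ (\int[mu]_t
  (2 * dotp (rcomb_dev b t) (rcomb_dev b t) +
   2 * dotp (rcomb_dev c' t) (rcomb_dev c' t))%:E)).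
  apply: le_integral_EFin.
  - exact: md.
  - by apply: measurable_funD; apply: measurable_funM => //; exact: md.
  - by move=> t; exact: dotp_ge0.
  - by move=> t; rewrite Ec dotp_sqrD.
rewrite ge0_integralD_EFin; last 4 first.
- by apply: measurable_funM => //; exact: md.
- by apply: measurable_funM => //; exact: md.
- by move=> t; rewrite mulr_ge0 ?dotp_ge0.
- by move=> t; rewrite mulr_ge0 ?dotp_ge0.
rewrite !ge0_integralZ_EFin//; try by [exact: md|move=> t; exact: dotp_ge0].
by rewrite leeD2r// lee_pmul2l//; exact: integral_sqr_rcomb_dev_le.
Qed.

End random_combination.

(** * Weighted averages *)

Section averaging.
Context {R : realType}.
Implicit Types (eta : R).

Lemma weight_gt0 eta k : eta < 1 -> 0 < weight eta k.
Proof. by move=> eta1; rewrite /weight invr_gt0 exprn_gt0// subr_gt0. Qed.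

Lemma sum_weight_gt0 eta K : eta < 1 -> 0 < \sum_(0 <= k < K.+1) weight eta k.
Proof.
move=> eta1; rewrite big_nat_recl//= ltr_wpDr ?weight_gt0// sumr_ge0// => k _.
by rewrite ltW// weight_gt0.
Qed.

(** Multiplying the recurrence by [weight eta k] makes the [A] terms telescope, because
    [weight eta k * (1 - eta)] is [(1 - eta) ^- k], the previous weight; at [k = 0] it is 1. The
    induction keeps the final [A K], dropped only at the end. *)
Lemma weighted_telescope (A G : nat -> R) eta c N : eta < 1 ->
  (forall k, 0 <= A k) ->
  (forall k, A k.+1 + c * G k <= (1 - eta) * A k + N) ->
  forall K, c * \sum_(0 <= k < K) weight eta k * G k <=
            A 0%N + N * \sum_(0 <= k < K) weight eta k.
Proof.
move=> eta1 A0 AG K.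
have eta0 : 0 < 1 - eta by rewrite subr_gt0.
suff : c * (\sum_(0 <= k < K) weight eta k * G k) + (1 - eta) ^- K * A K <=
       A 0%N + N * \sum_(0 <= k < K) weight eta k.
  by apply: le_trans; rewrite lerDl mulr_ge0// invr_ge0 exprn_ge0// ltW.
elim: K => [|K IH]; first by rewrite !big_geq// !mulr0 expr0 invr1 mul1r add0r addr0.
rewrite !big_nat_recr//=.
have := ler_wpM2l (ltW (weight_gt0 K eta1)) (AG K).
have -> : weight eta K * ((1 - eta) * A K + N) = (1 - eta) ^- K * A K + weight eta K * N.
  rewrite mulrDr mulrA; congr (_ * _ + _).
  by rewrite /weight exprSr invfM mulrVK// unitfE gt_eqF.
rewrite -/(weight eta K); lra.
Qed.

Lemma le_fine_recurrence (a a' g : \bar R) c b N :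
  a \is a fin_num -> a' \is a fin_num -> g \is a fin_num ->
  (a' + c%:E * g <= b%:E * a + N%:E)%E ->
  fine a' + c * fine g <= b * fine a + N.
Proof. by case: a a' g => [a| |] [a'| |] [g| |]. Qed.

(** Jensen by induction on [K]: the new average is a convex combination of the old one and the new
    point, with coefficient [W / W1]. *)
Lemma convex_weighted_average d (f : 'rV[R]_d -> R) eta K (x : nat -> 'rV[R]_d) :
  convex_function [set: convex_lmodType 'rV[R]_d] f -> eta < 1 ->
  f (weighted_average eta K x) <=
  (\sum_(0 <= k < K.+1) weight eta k)^-1 *
    \sum_(0 <= k < K.+1) weight eta k * f (x k).
Proof.
move=> cvxf eta1; elim: K => [|K IH].
  rewrite /weighted_average !big_nat1 scalerA mulrA mulVf ?scale1r ?mul1r//.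
  by rewrite gt_eqF// weight_gt0.
set W1 := (\sum_(0 <= k < K.+2) weight eta k).
set W := (\sum_(0 <= k < K.+1) weight eta k).
have Wp : 0 < W by exact: sum_weight_gt0.
have W1p : 0 < W1 by exact: sum_weight_gt0.
have wp := weight_gt0 K.+1 eta1.
have WE : W1 = W + weight eta K.+1 by rewrite /W1 big_nat_recr.
have t0 : 0 <= W / W1 by rewrite divr_ge0// ltW.
have t1 : W / W1 <= 1 by rewrite ler_pdivrMr// mul1r WE lerDl ltW.
have tC : 1 - W / W1 = weight eta K.+1 / W1.
  by rewrite -[1](@divff _ W1) ?gt_eqF// -mulrBl WE addrC addKr.
have -> : weighted_average eta K.+1 x =
    (W / W1) *: weighted_average eta K x + (1 - W / W1) *: x K.+1.
  rewrite tC /weighted_average -/W1 -/W big_nat_recr//= scalerDr !scalerA.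
  by congr (_ *: _ + _ *: _); [field; rewrite !gt_eqF|rewrite mulrC].
have /le_trans : f ((W / W1) *: weighted_average eta K x + (1 - W / W1) *: x K.+1) <=
    W / W1 * f (weighted_average eta K x) + (1 - W / W1) * f (x K.+1).
  exact: cvxf (Itv01 t0 t1) (weighted_average eta K x) (x K.+1) (in_setT _) (in_setT _).
apply; rewrite tC.
rewrite [X in _ <= _ * X]big_nat_recr//= mulrDr.
apply: lerD; last by rewrite mulrAC mulrC mulrA.
rewrite -/W in IH.
have -> : W / W1 * f (weighted_average eta K x) = W1^-1 * (W * f (weighted_average eta K x)).
  by rewrite [W / W1]mulrC mulrA.
rewrite ler_wpM2l ?invr_ge0 ?(ltW W1p)//.
by rewrite -(ler_pM2l Wp) mulVKf ?gt_eqF// in IH.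
Qed.

End averaging.

(** * Gradients and iterates *)

Section finite_sum_gradients.
Context {R : realType} {d n m : nat}.
Variable fs : 'I_n -> 'I_m -> 'rV[R]_d -> R.
Hypothesis dfs : forall i j x, differentiable (fs i j) x.

Definition scaled_gradient i x j : 'rV[R]_d := m%:R^-1 *: gradient (fs i j) x.

Lemma local_lossE i :
  local_loss fs i = fun x => \sum_(j < m) m%:R^-1 * fs i j x.
Proof. by apply/funext => x; rewrite /local_loss mulr_sumr. Qed.

Lemma stoch_lossE i xi :
  stoch_loss fs i xi = fun x => \sum_(j < m) (m%:R^-1 * tnth xi j) * fs i j x.
Proof.
apply/funext => x; rewrite /stoch_loss mulr_sumr.
by apply: eq_bigr => j _; rewrite mulrA.
Qed.

Lemma lossE : loss fs = fun x => \sum_(i < n) n%:R^-1 * local_loss fs i x.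
Proof. by apply/funext => x; rewrite -mulr_sumr. Qed.

Lemma differentiable_local_loss i x : differentiable (local_loss fs i) x.
Proof. by rewrite local_lossE; exact: differentiable_lincomb. Qed.

Lemma differentiable_loss x : differentiable (loss fs) x.
Proof.
by rewrite lossE; apply: differentiable_lincomb => i; exact: differentiable_local_loss.
Qed.

Lemma gradient_local_loss i x :
  gradient (local_loss fs i) x = \sum_j scaled_gradient i x j.
Proof. by rewrite local_lossE gradient_lincomb. Qed.

Lemma gradient_stoch_loss i xi x :
  gradient (stoch_loss fs i xi) x = rcomb (scaled_gradient i x) xi.
Proof.
rewrite stoch_lossE gradient_lincomb//; apply: eq_bigr => j _.
by rewrite scalerA mulrC.
Qed.

Lemma gradient_loss x :
  gradient (loss fs) x = n%:R^-1 *: \sum_i gradient (local_loss fs i) x.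
Proof.
rewrite lossE gradient_lincomb ?scaler_sumr// => i.
exact: differentiable_local_loss.
Qed.

Lemma gradient_stoch_loss_dev i xi x :
  gradient (stoch_loss fs i xi) x - gradient (local_loss fs i) x =
  rcomb_dev (scaled_gradient i x) xi.
Proof. by rewrite gradient_stoch_loss gradient_local_loss. Qed.

Section measurability.
Context {dT : measure_display} {T : measurableType dT}.

Lemma measurable_stoch_gradient i (xi : T -> m.-tuple R) (X : T -> 'rV[R]_d) :
  measurable_fun setT xi -> measurable_row X ->
  measurable_row (fun w => gradient (stoch_loss fs i (xi w)) (X w)).
Proof.
move=> mxi mX.
rewrite (_ : (fun w => _) = fun w => \sum_j tnth (xi w) j *:
    (m%:R^-1 *: gradient (fs i j) (X w))); last first.
  by apply/funext => w; rewrite gradient_stoch_loss.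
apply: measurable_row_sum => j; apply: measurable_rowZ.
  by move/measurable_fun_tnthP: mxi; exact.
apply: measurable_rowZ => //.
by apply: measurable_gradient.
Qed.

Lemma measurable_local_gradient i (X : T -> 'rV[R]_d) : measurable_row X ->
  measurable_row (fun w => gradient (local_loss fs i) (X w)).
Proof.
by move=> mX; apply: measurable_gradient => // x; exact: differentiable_local_loss.
Qed.

Lemma measurable_stoch_gradient_dev i (xi : T -> m.-tuple R) (X : T -> 'rV[R]_d) :
  measurable_fun setT xi -> measurable_row X ->
  measurable_row (fun w => rcomb_dev (scaled_gradient i (X w)) (xi w)).
Proof.
move=> mxi mX; under eq_fun do rewrite -gradient_stoch_loss_dev.
apply: measurable_rowB; last exact: measurable_local_gradient.
exact: measurable_stoch_gradient.
Qed.

Lemma measurable_loss (X : T -> 'rV[R]_d) : measurable_row X ->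
  measurable_fun setT (fun w => loss fs (X w)).
Proof.
apply: measurable_continuous_row => x.
by apply: differentiable_continuous; exact: differentiable_loss.
Qed.

Lemma measurable_local_loss i (X : T -> 'rV[R]_d) : measurable_row X ->
  measurable_fun setT (fun w => local_loss fs i (X w)).
Proof.
apply: measurable_continuous_row => x.
by apply: differentiable_continuous; exact: differentiable_local_loss.
Qed.

Context {dZ : measure_display} {Z : measurableType dZ}.
Variables (C : Z -> 'rV[R]_d -> 'rV[R]_d) (mC : measurable_operator C).

Lemma measurable_compression (zeta : T -> Z) (X : T -> 'rV[R]_d) :
  measurable_fun setT zeta -> measurable_row X ->
  measurable_row (fun w => C (zeta w) (X w)).
Proof.
move=> mz mX j.
rewrite (_ : (fun w => _) = (fun p => C p.1 (\row_i tnth p.2 i) 0 j) \o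
   (fun w => (zeta w, [tuple X w 0 i | i < d]))); last first.
  apply/funext => w /=; congr (C _ _ _ _).
  by apply/rowP => i; rewrite mxE tnth_mktuple.
apply: measurableT_comp; first exact: mC.
by apply: measurable_fun_pair => //; exact: measurable_row_tuple.
Qed.

Variables (gamma : R) (x0 : 'rV[R]_d).

(** The full state, with [ec_sgd_as] as first component. The domain of the seeds is an arbitrary
    type, so that the same process can be viewed on [Omega] and on [other_seeds s]. *)
Definition as_state {T' : Type} (xi : nat -> 'I_n -> T' -> m.-tuple R)
    (zeta : nat -> 'I_n -> T' -> Z) k w :=
  ec_sgd gamma x0 (fun k i => gradient (stoch_loss fs i (xi k i w)))
    (fun k i => C (zeta k i w)) k.

(** Measurability is asked only of seeds of steps before [k]; the lemma thus applies on
    [other_seeds s] for every seed [s] of step [k] or later. *)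
Lemma measurable_as_state (xi : nat -> 'I_n -> T -> m.-tuple R)
    (zeta : nat -> 'I_n -> T -> Z) k :
  (forall j i, (j < k)%N -> measurable_fun setT (xi j i)) ->
  (forall j i, (j < k)%N -> measurable_fun setT (zeta j i)) ->
  measurable_row (fun w => (as_state xi zeta k w).1) /\
  forall i, measurable_row (fun w => (as_state xi zeta k w).2 i).
Proof.
elim: k => [_ _|k IH mxi mz].
  split; first exact: measurable_row_cst.
  by move=> i; exact: measurable_row_cst.
have [||mx me] := IH.
- by move=> j i jk; apply: mxi; exact: ltnW.
- by move=> j i jk; apply: mz; exact: ltnW.
have mg i := measurable_stoch_gradient i (mxi k i (ltnSn k)) mx.
have my i : measurable_row (fun w => gamma^-1 *: ((as_state xi zeta k w).2 i +
    gamma *: gradient (stoch_loss fs i (xi k i w)) (as_state xi zeta k w).1)).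
  apply: measurable_rowZ => //; apply: measurable_rowD; first exact: me.
  by apply: measurable_rowZ.
have mc i := measurable_compression (mz k i (ltnSn k)) (my i).
have E w : as_state xi zeta k.+1 w =
  ((as_state xi zeta k w).1 - n%:R^-1 *: \sum_i gamma *: C (zeta k i w)
    (gamma^-1 *: ((as_state xi zeta k w).2 i +
    gamma *: gradient (stoch_loss fs i (xi k i w)) (as_state xi zeta k w).1)),
   fun i => (as_state xi zeta k w).2 i +
    gamma *: gradient (stoch_loss fs i (xi k i w)) (as_state xi zeta k w).1 -
    gamma *: C (zeta k i w) (gamma^-1 *: ((as_state xi zeta k w).2 i +
    gamma *: gradient (stoch_loss fs i (xi k i w)) (as_state xi zeta k w).1))).
  by rewrite /as_state /=; case: (ec_sgd _ _ _ _ k).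
split.
  under eq_fun do rewrite E.
  apply: measurable_rowB => //; apply: measurable_rowZ => //.
  apply: measurable_row_sum => i; exact: measurable_rowZ.
move=> i; under eq_fun do rewrite E.
apply: measurable_rowB; last exact: measurable_rowZ.
by apply: measurable_rowD; [exact: me|exact: measurable_rowZ].
Qed.

End measurability.
End finite_sum_gradients.

(** * One step in expectation *)

(** The scalar core of [virtual_descent]. Of the gain [2 * gamma * G], a quarter pays for the error
    cross term, a quarter is released on the left, and the remaining [gamma * G] absorbs
    [A1 + 4 * A], the squared gradient and the gap part of the variance. *)
Lemma descent_arith (R : realFieldType) (mu L gamma A B A1 B1 r2 u2 e2 G p q : R) :
  gamma * (G + mu / 2 * u2) <= gamma * p ->
  gamma * (2 * q) <= gamma * (8 * L * e2 + G / 2) ->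
  gamma * mu * r2 <= gamma * mu * (2 * u2 + 2 * e2) ->
  gamma * (mu * e2) <= gamma * (2 * L * e2) ->
  A1 <= B1 -> B1 + 8 * A <= gamma * 1 * G -> 0 <= A ->
  r2 - 2 * gamma * p + gamma * (2 * q) + A1 + (4 * A + B) + gamma / 2 * G <=
  (1 - gamma * mu / 2) * r2 + 10 * L * gamma * e2 + B.
Proof. lra. Qed.

Section ec_sgd_descent.
Context {R : realType} {d n m : nat}.
Variables (fs : 'I_n -> 'I_m -> 'rV[R]_d -> R).
Variable D : 'I_n -> probability (m.-tuple R) R.
Variables (mu L calL sigma2 : R) (xs : 'rV[R]_d).
Hypothesis n_gt0 : (0 < n)%N.
Hypothesis dfs : forall i j x, differentiable (fs i j) x.
Hypothesis xs_min : forall y, loss fs xs <= loss fs y.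
Hypotheses (mu_ge0 : 0 <= mu) (qsc : quasi_strongly_convex mu (loss fs) xs).
Hypotheses (L_ge0 : 0 <= L) (smooth_loss : smooth L (loss fs)).
Hypothesis mean1 : unit_mean D.
Hypotheses (calL_gt0 : 0 < calL) (es : expected_smoothness fs D calL xs).
Hypothesis sigma2E : sigma_star2 fs D xs = sigma2%:E.

Let gloss x := gradient (loss fs) x.
Let gloc i x := gradient (local_loss fs i) x.
Let gap x := loss fs x - loss fs xs.
Let sqn (u : 'rV[R]_d) := dotp u u.

Definition bregman i x :=
  local_loss fs i x - local_loss fs i xs - dotp (gloc i xs) (x - xs).

Definition sampling_variance i x : \bar R :=
  (\int[D i]_t (dotp (rcomb_dev (scaled_gradient fs i x) t)
                  (rcomb_dev (scaled_gradient fs i x) t))%:E)%E.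

Definition variance_bound i x :=
  4 * calL * bregman i x + 2 * fine (sampling_variance i xs).

Lemma nR_gt0 : (0 : R) < n%:R. Proof. by rewrite ltr0n. Qed.

Lemma sampling_variance_ge0 i x : (0 <= sampling_variance i x)%E.
Proof. by apply: integral_ge0 => t _; rewrite lee_fin dotp_ge0. Qed.

(** Only the average loss is assumed convex; the sign comes from expected smoothness, whose left
    side is an expectation of squares. *)
Lemma bregman_ge0 i x : 0 <= bregman i x.
Proof.
have c0 : 0 < 2 * calL by rewrite mulr_gt0.
rewrite -(pmulr_rge0 _ c0) -lee_fin; apply: le_trans (es x i).
by rewrite expectation_ge0// => t; exact: sqr_ge0.
Qed.

Lemma sigma_star2_sum :
  ((n%:R^-1)%:E * \sum_(i < n) sampling_variance i xs = sigma2%:E)%E.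
Proof.
rewrite -sigma2E /sigma_star2; congr (_ * _)%E; apply: eq_bigr => i _.
rewrite unlock; apply: eq_integral => t _.
by rewrite gradient_stoch_loss_dev// enorm_sqr.
Qed.

(** A real [sigma2] forces this: the variances are nonnegative, and one infinite term would make
    [sigma_star2] infinite. *)
Lemma sampling_variance_fin_num i : sampling_variance i xs \is a fin_num.
Proof.
rewrite ge0_fin_numE ?sampling_variance_ge0// ltey; apply/eqP => voo.
have := sigma_star2_sum; rewrite (bigD1 i)//= voo addye; last first.
  rewrite -ltNye (lt_le_trans (ltNyr 0))//; apply: sume_ge0 => j _.
  exact: sampling_variance_ge0.
by rewrite gt0_muley// lte_fin invr_gt0 nR_gt0.
Qed.

Lemma sum_sampling_variance :
  n%:R^-1 * \sum_(i < n) fine (sampling_variance i xs) = sigma2.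
Proof.
apply: EFin_inj; rewrite -sigma_star2_sum EFinM -sumEFin; congr (_ * _)%E.
by apply: eq_bigr => i _; rewrite fineK// sampling_variance_fin_num.
Qed.

Lemma sigma2_ge0 : 0 <= sigma2.
Proof.
rewrite -sum_sampling_variance mulr_ge0 ?invr_ge0 ?(ltW nR_gt0)// sumr_ge0// => i _.
by rewrite fine_ge0// sampling_variance_ge0.
Qed.

Lemma variance_bound_ge0 i x : 0 <= variance_bound i x.
Proof.
apply: addr_ge0; apply: mulr_ge0 => //.
- by rewrite mulr_ge0// ltW.
- exact: bregman_ge0.
- by rewrite fine_ge0// sampling_variance_ge0.
Qed.

Lemma sampling_variance_le i x : (sampling_variance i x <= (variance_bound i x)%:E)%E.
Proof.
apply: le_trans (integral_sqr_rcomb_dev_split (mean1 i) _ (scaled_gradient fs i xs)) _.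
have -> : variance_bound i x =
    2 * (2 * calL * bregman i x) + 2 * fine (sampling_variance i xs).
  by rewrite /variance_bound; ring.
rewrite [X in (_ <= X)%E]EFinD [in X in (_ <= X + _)%E]EFinM [in X in (_ <= _ + X)%E]EFinM.
rewrite fineK ?sampling_variance_fin_num// leeD2r//.
rewrite lee_pmul2l//; have := es x i; rewrite unlock.
by under eq_integral do rewrite !gradient_stoch_loss// enorm_sqr.
Qed.

Lemma measurable_variance_bound i {dT} {T : measurableType dT} (X : T -> 'rV[R]_d) :
  measurable_row X -> measurable_fun setT (fun w => variance_bound i (X w)).
Proof.
move=> mX; apply: measurable_funD => //; apply: measurable_funM => //.
apply: measurable_funB.
  by apply: measurable_funB => //; exact: measurable_local_loss.
apply: measurable_dotp; first exact: (measurable_row_cst (gloc i xs)).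
by apply: measurable_rowB => //; exact: (measurable_row_cst xs).
Qed.

Lemma gloss_xs : gloss xs = 0.
Proof. exact: (gradient_minimizer L_ge0 (differentiable_loss dfs) smooth_loss). Qed.

Lemma mean_bregman x : n%:R^-1 * \sum_i bregman i x = gap x.
Proof.
rewrite /bregman /gap /loss !sumrB !mulrBr -dotp_suml -dotpZl.
by rewrite -gradient_loss// -/(gloss xs) gloss_xs dotp0l subr0.
Qed.

Lemma mean_variance_bound x :
  n%:R^-1 * \sum_i variance_bound i x = 4 * calL * gap x + 2 * sigma2.
Proof.
rewrite /variance_bound big_split/= -!mulr_sumr mulrDr.
rewrite -mean_bregman -sum_sampling_variance; ring.
Qed.

(* [x] is the actual iterate, [x - e] the virtual one. *)
Lemma virtual_descent gamma x e :
  0 < gamma -> gamma * (4 * L + 8 * calL / n%:R) <= 1 ->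
  sqn (x - e - xs - gamma *: gloss x)
    + (gamma / n%:R) ^+ 2 * \sum_i variance_bound i x
    + gamma / 2 * gap x
  <= (1 - gamma * mu / 2) * sqn (x - e - xs) + 10 * L * gamma * sqn e
    + 2 * gamma ^+ 2 * sigma2 / n%:R.
Proof.
move=> gamma0 gamma_le; set r := x - e - xs; pose u := x - xs.
have -> : (gamma / n%:R) ^+ 2 * \sum_i variance_bound i x =
    gamma ^+ 2 / n%:R * (4 * calL * gap x + 2 * sigma2).
  rewrite -mean_variance_bound; field; exact: lt0r_neq0 nR_gt0.
have gap0 : 0 <= gap x by rewrite subr_ge0.
have gg : sqn (gloss x) <= 4 * L * gap x.
  exact: (gradient_sqr_le L_ge0 (differentiable_loss dfs) smooth_loss).
have ue : r = u - e by rewrite /r /u addrAC.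
have h1 : gap x + mu / 2 * sqn u <= dotp (gloss x) u.
  have := qsc x; rewrite enorm_sqr -opprB dotpNr -/u /gap /sqn /gloss; lra.
(* Weight [8 * L] in Young's inequality makes the gradient term at most
   [(8 * L)^-1 * (4 * L * gap x) = gap x / 2]; for [L = 0] the gradient is zero by [gg]. *)
have h2 : 2 * dotp e (gloss x) <= 8 * L * sqn e + gap x / 2.
  have [L0|Ln0] := eqVneq L 0.
    have -> : gloss x = 0.
      apply: dotp_eq0; apply/eqP; rewrite eq_le dotp_ge0 andbT.
      by move: gg; rewrite L0 mulr0 mul0r.
    by rewrite dotp0r L0 !mulr0 mul0r add0r divr_ge0.
  have Lp : 0 < 8 * L by rewrite mulr_gt0// lt_neqAle eq_sym Ln0.
  apply: le_trans (dotp_young _ _ Lp) _; rewrite lerD2l.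
  rewrite mulrC ler_pdivrMr//.
  by have -> : gap x / 2 * (8 * L) = 4 * L * gap x by field.
(* Contraction is available for the actual offset [u] and wanted for the virtual [r]: half of it
   passes to [r], at the price of [mu * sqn e], which [h4] converts into a multiple of
   [L * sqn e]. *)
have h3 : sqn r <= 2 * sqn u + 2 * sqn e.
  rewrite ue; apply: le_trans (dotp_sqrD _ _) _.
  by rewrite dotpNl dotpNr opprK.
have h4 : mu * sqn e <= 2 * L * sqn e.
  exact: (quasi_strong_convexity_le_smoothness L_ge0 (differentiable_loss dfs)
    smooth_loss xs_min qsc).
have E (a b g : 'rV[R]_d) : sqn (a - b - gamma *: g) =
    sqn (a - b) - 2 * gamma * dotp g a + gamma * (2 * dotp b g) + gamma ^+ 2 * sqn g.
  by rewrite /sqn !dotpE (dotpC a g) (dotpC g b) (dotpC a b); ring.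
rewrite {1}ue E -ue.
have k1 := ler_wpM2l (ltW gamma0) h1.
have k2 := ler_wpM2l (ltW gamma0) h2.
have k3 : gamma * mu * sqn r <= gamma * mu * (2 * sqn u + 2 * sqn e).
  by rewrite ler_wpM2l// mulr_ge0// ltW.
have k4 := ler_wpM2l (ltW gamma0) h4.
have k5 : gamma ^+ 2 * sqn (gloss x) <= gamma ^+ 2 * (4 * L * gap x).
  by rewrite ler_wpM2l// sqr_ge0.
have k6 : gamma * (gamma * (4 * L + 8 * calL / n%:R)) * gap x <= gamma * 1 * gap x.
  by rewrite ler_wpM2r// ler_wpM2l// ltW.
have k7 : 0 <= gamma ^+ 2 * calL / n%:R * gap x.
  apply: mulr_ge0 => //; apply: divr_ge0; rewrite ?ler0n//.
  by apply: mulr_ge0; [exact: sqr_ge0|exact: ltW].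
have -> : gamma ^+ 2 / n%:R * (4 * calL * gap x + 2 * sigma2) =
  4 * (gamma ^+ 2 * calL / n%:R * gap x) + 2 * gamma ^+ 2 * sigma2 / n%:R by ring.
have k6' : gamma * (gamma * (4 * L + 8 * calL / n%:R)) * gap x =
   gamma ^+ 2 * (4 * L * gap x) + 8 * (gamma ^+ 2 * calL / n%:R * gap x) by ring.
rewrite k6' in k6.
exact: descent_arith k1 k2 k3 k4 k5 k6 k7.
Qed.

(** * A run with fixed stepsize: errors, virtual iterates, sampling *)

Context {dZ : measure_display} {Z : measurableType dZ}.
Variables (Q : probability Z R) (C : Z -> 'rV[R]_d -> 'rV[R]_d) (Delta : R).
Hypothesis compC : absolute_compression Q C Delta.
Variables (x0 : 'rV[R]_d) (gamma : R).
Hypotheses (gamma_gt0 : 0 < gamma)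
  (gamma_le : gamma * (4 * L + 8 * calL / n%:R) <= 1).
Context {dO : measure_display} {Omega : measurableType dO}.
Variables (P : probability Omega R).
Variables (xi : nat -> 'I_n -> Omega -> m.-tuple R) (zeta : nat -> 'I_n -> Omega -> Z).
Hypothesis fresh : fresh_sampling P D Q xi zeta.

Let state k w := as_state fs C gamma x0 xi zeta k w.
Let iter k w := (state k w).1.
Let err k i w := (state k w).2 i.
Let sgrad k i w := gradient (stoch_loss fs i (xi k i w)) (iter k w).
Let mean_err k w := n%:R^-1 *: \sum_i err k i w.
(* Offset of the virtual iterate from [xs]. *)
Let dist k w := iter k w - mean_err k w - xs.
Let comp_arg k i w := gamma^-1 *: (err k i w + gamma *: sgrad k i w).

Let mC : measurable_operator C. Proof. by case: compC. Qed.

Definition seed_step (s : (nat * 'I_n) + (nat * 'I_n)) :=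
  match s with inl (k, _) | inr (k, _) => k end.

Lemma stateS k w : state k.+1 w =
  (iter k w - n%:R^-1 *: \sum_i gamma *: C (zeta k i w) (comp_arg k i w),
   fun i => err k i w + gamma *: sgrad k i w - gamma *: C (zeta k i w) (comp_arg k i w)).
Proof.
rewrite /comp_arg /sgrad /iter /err /state /as_state /=.
by case: (ec_sgd _ _ _ _ k).
Qed.

Lemma errS k i w :
  err k.+1 i w = - (gamma *: (C (zeta k i w) (comp_arg k i w) - comp_arg k i w)).
Proof.
rewrite /err stateS /= scalerBr opprB [in gamma *: comp_arg k i w]/comp_arg.
by rewrite scalerA divff ?scale1r// gt_eqF.
Qed.

Lemma distS k w : dist k.+1 w = dist k w - (gamma / n%:R) *: \sum_i sgrad k i w.
Proof.
have E : \sum_i err k.+1 i w = \sum_i err k i w + gamma *: \sum_i sgrad k i w -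
    \sum_i gamma *: C (zeta k i w) (comp_arg k i w).
  by rewrite /err stateS /= sumrB big_split/= -scaler_sumr.
rewrite /dist /mean_err E [iter k.+1 w]/iter stateS /=.
rewrite scalerBr scalerDr scalerA [_^-1 * gamma]mulrC.
by apply/rowP => j; rewrite !mxE; ring.
Qed.

Lemma measurable_state_others s k : (k <= seed_step s)%N ->
  @measurable_row R d _ (other_seeds xi zeta s) (iter k) /\
  forall i, @measurable_row R d _ (other_seeds xi zeta s) (err k i).
Proof.
move=> ks.
apply: (@measurable_as_state _ _ _ _ _ dfs _ (other_seeds xi zeta s)
  _ _ _ mC gamma x0 xi zeta k).
  move=> j i jk; apply: measurable_other_xi; apply: contraTneq ks => <-.
  by rewrite -ltnNge.
move=> j i jk; apply: measurable_other_zeta; apply: contraTneq ks => <-.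
by rewrite -ltnNge.
Qed.

Lemma measurable_sgrad_others s k i : (k <= seed_step s)%N -> inl (k, i) != s ->
  @measurable_row R d _ (other_seeds xi zeta s) (sgrad k i).
Proof.
move=> ks kis; apply: (measurable_stoch_gradient dfs).
  exact: measurable_other_xi.
by have [] := measurable_state_others ks.
Qed.

Lemma measurable_state k : measurable_row (iter k) /\ forall i, measurable_row (err k i).
Proof.
have [lxi lzeta _] := fresh.
by apply: (@measurable_as_state _ _ _ _ _ dfs _ Omega _ _ _ mC gamma x0 xi zeta k) => j i _;
   [have [] := lxi j i|have [] := lzeta j i].
Qed.

Lemma measurable_dist k : measurable_row (dist k).
Proof.
have [mi me] := measurable_state k.
apply: measurable_rowB; last exact: measurable_row_cst.
apply: measurable_rowB => //; apply: measurable_rowZ => //.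
exact: measurable_row_sum.
Qed.

(** The seed [zeta k i] is integrated out with [comp_arg k i] frozen. That argument uses the sample
    [xi k i] of the same worker and step, but this is a different, independent seed. *)
Lemma sqr_err_le k i :
  (\int[P]_w (sqn (err k i w))%:E <= (gamma ^+ 2 * Delta ^+ 2)%:E)%E.
Proof.
have [_ _ bC] := compC; have [_ lzeta _] := fresh.
case: k => [|k].
  under eq_integral do rewrite /sqn dotp0l.
  by rewrite integral0 lee_fin mulr_ge0 ?sqr_ge0.
pose s : (nat * 'I_n) + (nat * 'I_n) := inr (k, i).
have [mi me] := measurable_state_others (leqnn k : (k <= seed_step s)%N).
have my : @measurable_row R d _ (other_seeds xi zeta s) (comp_arg k i).
  apply: measurable_rowZ => //; apply: measurable_rowD; first exact: me.
  by apply: measurable_rowZ => //; exact: measurable_sgrad_others.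
pose f (p : other_seeds xi zeta s * Z) : \bar R :=
  (gamma ^+ 2 * sqn (C p.2 (comp_arg k i p.1) - comp_arg k i p.1))%:E.
have mf : measurable_fun setT f.
  apply/measurable_EFinP; apply: measurable_funM => //.
  have my1 : measurable_row (fun p : other_seeds xi zeta s * Z => comp_arg k i p.1).
    by move=> j; apply: (measurableT_comp (my j)).
  have mcy : measurable_row (fun p : other_seeds xi zeta s * Z =>
      C p.2 (comp_arg k i p.1) - comp_arg k i p.1).
    by apply: measurable_rowB => //; apply: (measurable_compression mC).
  exact: measurable_dotp.
have E w : (sqn (err k.+1 i w))%:E = f (w, zeta k i w).
  rewrite /f /= errS /sqn dotpNl dotpNr opprK dotpZl dotpZr.
  by rewrite mulrA -expr2.
under eq_integral do rewrite E.
rewrite -[leRHS](integral_cst_EFin P).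
apply: (freezing_seed_le fresh (f := f) erefl (lzeta k i)) => //.
  by move=> p; rewrite lee_fin mulr_ge0 ?sqr_ge0 ?dotp_ge0.
move=> w; rewrite /f /= ge0_integralZ_EFin ?sqr_ge0//.
- rewrite [X in (_ <= X)%E]EFinM; apply: lee_wpmul2l; first by rewrite lee_fin sqr_ge0.
  have := bC (comp_arg k i w); rewrite unlock.
  by under eq_integral do rewrite enorm_sqr.
- have mb : measurable_row (fun z => C z (comp_arg k i w) - comp_arg k i w).
    apply: measurable_rowB; last exact: measurable_row_cst.
    exact: (measurable_compression mC (@measurable_id _ Z setT)
      (measurable_row_cst (comp_arg k i w))).
  exact: measurable_dotp.
- by move=> z; exact: dotp_ge0.
Qed.

Lemma sqr_mean_err_le k :
  (\int[P]_w (sqn (mean_err k w))%:E <= (gamma ^+ 2 * Delta ^+ 2)%:E)%E.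
Proof.
have [_ me] := measurable_state k.
have msq i : measurable_fun setT (fun w => sqn (err k i w)).
  by apply: measurable_dotp; exact: me.
have /le_trans : (\int[P]_w (sqn (mean_err k w))%:E <=
    \int[P]_w (n%:R^-1 * \sum_i sqn (err k i w))%:E)%E.
  apply: le_integral_EFin.
  - have mm : measurable_row (mean_err k).
      by apply: measurable_rowZ => //; exact: measurable_row_sum.
    exact: measurable_dotp.
  - by apply: measurable_funM => //; apply: measurable_sum.
  - by move=> w; exact: dotp_ge0.
  - by move=> w; exact: dotp_mean.
apply; rewrite ge0_integralZ_EFin ?invr_ge0//; last 2 first.
- exact: measurable_sum.
- by move=> w; apply: sumr_ge0 => i _; exact: dotp_ge0.
rewrite lee_pdivrMl ?nR_gt0//.
under eq_integral do rewrite -sumEFin.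
rewrite ge0_integral_sum//; last 2 first.
- by move=> i; exact/measurable_EFinP.
- by move=> i w _; rewrite lee_fin dotp_ge0.
apply: le_trans (lee_sum _ (fun i _ => sqr_err_le k i)) _.
by rewrite sumEFin lee_fin sumr_const card_ord mulr_natl.
Qed.

(* Workers [i < l] have already drawn their sample; the others still use their
   exact gradient. *)
Let hybrid k l w := dist k w - (gamma / n%:R) *:
  \sum_(i < n) (if (i < l)%N then sgrad k i w else gloc i (iter k w)).

Lemma hybridS k (l : 'I_n) w : hybrid k l.+1 w = hybrid k l w +
  (- (gamma / n%:R)) *: rcomb_dev (scaled_gradient fs l (iter k w)) (xi k l w).
Proof.
rewrite /hybrid -gradient_stoch_loss_dev// -/(gloc l _) -/(sgrad k l w).
rewrite (bigD1 l)//= ltnSn [in RHS](bigD1 l)//= ltnn.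
have -> : \sum_(i < n | i != l) (if (i < l.+1)%N then sgrad k i w else gloc i (iter k w)) =
    \sum_(i < n | i != l) (if (i < l)%N then sgrad k i w else gloc i (iter k w)).
  by apply: eq_bigr => i il; rewrite ltnS leq_eqVlt (negbTE (il : val i != val l)).
move: (\sum_(i < n | i != l) _) (sgrad k l w) (gloc l _) (dist k w) => S a b c.
rewrite scaleNr -addrA -opprD -scalerDr; congr (_ - _ *: _).
by rewrite [RHS]addrC addrA subrK.
Qed.

(** [hybrid k l] involves earlier steps and the step-[k] samples of workers below [l] only, so it is
    measurable on [other_seeds s]; with it frozen, [integral_sqr_rcomb] adds the variance of worker
    [l] and no cross term. *)
Lemma hybrid_step k (l : 'I_n) :
  (\int[P]_w (sqn (hybrid k l.+1 w))%:E <=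
   \int[P]_w (sqn (hybrid k l w) +
     (gamma / n%:R) ^+ 2 * variance_bound l (iter k w))%:E)%E.
Proof.
have [lxi _ _] := fresh.
pose s : (nat * 'I_n) + (nat * 'I_n) := inl (k, l).
have [mi me] := measurable_state_others (leqnn k : (k <= seed_step s)%N).
have mh : @measurable_row R d _ (other_seeds xi zeta s) (hybrid k l).
  apply: measurable_rowB.
    apply: measurable_rowB; last exact: measurable_row_cst.
    apply: measurable_rowB => //; apply: measurable_rowZ => //.
    exact: measurable_row_sum.
  apply: measurable_rowZ => //; apply: measurable_row_sum => i.
  case: (boolP (i < l)%N) => il; last exact: measurable_local_gradient.
  apply: measurable_sgrad_others => //.
  by rewrite /s; apply/eqP => -[E]; rewrite E ltnn in il.
pose f (p : other_seeds xi zeta s * m.-tuple R) : \bar R :=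
  (sqn (hybrid k l p.1 + (- (gamma / n%:R)) *:
     rcomb_dev (scaled_gradient fs l (iter k p.1)) p.2))%:E.
have mf : measurable_fun setT f.
  apply/measurable_EFinP.
  have mi1 : measurable_row (fun p : other_seeds xi zeta s * m.-tuple R => iter k p.1).
    by move=> j; apply: (measurableT_comp (mi j)).
  have mb : measurable_row (fun p : other_seeds xi zeta s * m.-tuple R =>
      hybrid k l p.1 + (- (gamma / n%:R)) *:
        rcomb_dev (scaled_gradient fs l (iter k p.1)) p.2).
    apply: measurable_rowD.
      by move=> j; apply: (measurableT_comp (mh j)).
    apply: measurable_rowZ => //.
    exact: measurable_stoch_gradient_dev.
  exact: measurable_dotp.
have E w : (sqn (hybrid k l.+1 w))%:E = f (w, xi k l w) by rewrite hybridS.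
under eq_integral do rewrite E.
apply: (freezing_seed_le fresh (f := f) erefl (lxi k l)) => //.
- by move=> p; rewrite lee_fin dotp_ge0.
- apply/measurable_EFinP; apply: measurable_funD.
    have mh' : measurable_row (hybrid k l).
      by move=> j; apply: (measurable_of_others fresh (mh j)).
    exact: measurable_dotp.
  apply: measurable_funM => //; apply: measurable_variance_bound.
  by have [] := measurable_state k.
- move=> w; rewrite /f /= integral_sqr_rcomb; last exact: mean1.
  rewrite sqrrN [X in (_ <= X)%E]EFinD [X in (_ <= _ + X)%E]EFinM leeD2l//.
  apply: lee_wpmul2l; first by rewrite lee_fin sqr_ge0.
  exact: sampling_variance_le.
Qed.

Lemma measurable_hybrid k l : measurable_row (hybrid k l).
Proof.
have [lxi _ _] := fresh; have [mi me] := measurable_state k.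
apply: measurable_rowB; first exact: measurable_dist.
apply: measurable_rowZ => //; apply: measurable_row_sum => i.
case: (boolP (i < l)%N) => il; last exact: measurable_local_gradient.
by apply: measurable_stoch_gradient => //; have [] := lxi k i.
Qed.

Lemma hybrid_le k l : (l <= n)%N ->
  (\int[P]_w (sqn (hybrid k l w))%:E <=
   \int[P]_w (sqn (hybrid k 0 w) + (gamma / n%:R) ^+ 2 *
     \sum_(i < n | (i < l)%N) variance_bound i (iter k w))%:E)%E.
Proof.
have [mi me] := measurable_state k.
have mV i : measurable_fun setT (fun w => (gamma / n%:R) ^+ 2 * variance_bound i (iter k w)).
  by apply: measurable_funM => //; exact: measurable_variance_bound.
have V0 i w : 0 <= (gamma / n%:R) ^+ 2 * variance_bound i (iter k w).
  by apply: mulr_ge0; [exact: sqr_ge0|exact: variance_bound_ge0].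
have mh l' : measurable_fun setT (fun w => sqn (hybrid k l' w)).
  by apply: measurable_dotp; exact: measurable_hybrid.
have h0 l' w : 0 <= sqn (hybrid k l' w) by exact: dotp_ge0.
have mS l' : measurable_fun setT (fun w => sqn (hybrid k 0 w) + (gamma / n%:R) ^+ 2 *
     \sum_(i < n | (i < l')%N) variance_bound i (iter k w)).
  apply: measurable_funD => //; apply: measurable_funM => //.
  under eq_fun do rewrite -big_filter.
  apply: (@measurable_sum _ _ _ _ _ _ (fun i w => variance_bound i (iter k w))) => i.
  exact: measurable_variance_bound.
have S0 l' w : 0 <= sqn (hybrid k 0 w) + (gamma / n%:R) ^+ 2 *
     \sum_(i < n | (i < l')%N) variance_bound i (iter k w).
  by rewrite addr_ge0// mulr_sumr sumr_ge0.
elim: l => [_|l IH ln].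
  by under [X in (_ <= X)%E]eq_integral do rewrite big_pred0// mulr0 addr0.
pose o := Ordinal ln; apply: le_trans (hybrid_step k o) _.
rewrite ge0_integralD_EFin//.
apply: le_trans (leeD2r _ (IH (ltnW ln))) _.
rewrite -ge0_integralD_EFin// le_eqVlt; apply/orP; left; apply/eqP.
apply: eq_integral => w _; congr EFin; rewrite -addrA -mulrDr; congr (_ + _ * _).
rewrite [RHS](bigD1 o)//= addrC; congr (_ + _); apply: eq_bigl => i.
by rewrite ltnS ltn_neqAle andbC.
Qed.

Lemma hybrid0 k w : hybrid k 0 w = dist k w - gamma *: gloss (iter k w).
Proof. by rewrite /hybrid /= /gloss gradient_loss// scalerA. Qed.

Lemma hybrid_all k w : hybrid k n w = dist k.+1 w.
Proof.
by rewrite distS /hybrid; under eq_bigr do rewrite ltn_ord.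
Qed.

Let gap_ge0 x : 0 <= gap x. Proof. by rewrite subr_ge0. Qed.

Let measurable_gap k : measurable_fun setT (fun w => gap (iter k w)).
Proof.
apply: measurable_funB => //; apply: measurable_loss => //.
by have [] := measurable_state k.
Qed.

Let measurable_sqr_dist k : measurable_fun setT (fun w => sqn (dist k w)).
Proof. by apply: measurable_dotp; exact: measurable_dist. Qed.

(** Stated for extended-real integrals, since their finiteness is deduced from it. A general [eta]
    accommodates the cap [1 / 4] in the averaging rate. *)
Lemma expected_descent eta k : eta <= gamma * mu / 2 -> eta <= 1 ->
  (\int[P]_w (sqn (dist k.+1 w))%:E + \int[P]_w (gamma / 2 * gap (iter k w))%:E <=
   (1 - eta)%:E * \int[P]_w (sqn (dist k w))%:E +
   (10 * L * gamma * (gamma ^+ 2 * Delta ^+ 2) + 2 * gamma ^+ 2 * sigma2 / n%:R)%:E)%E.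
Proof.
move=> eta_le eta1; have [mi me] := measurable_state k.
have mgap : measurable_fun setT (fun w => gamma / 2 * gap (iter k w)).
  by apply: measurable_funM.
have gap0 w : 0 <= gamma / 2 * gap (iter k w) by rewrite mulr_ge0// divr_ge0// ltW.
have me2 : measurable_fun setT (fun w => 10 * L * gamma * sqn (mean_err k w)).
  apply: measurable_funM => //.
  have mm : measurable_row (mean_err k).
    by apply: measurable_rowZ => //; exact: measurable_row_sum.
  exact: measurable_dotp.
have cL : 0 <= 10 * L * gamma by rewrite !mulr_ge0// ltW.
have e20 w : 0 <= 10 * L * gamma * sqn (mean_err k w) by rewrite mulr_ge0// dotp_ge0.
have md2 : measurable_fun setT (fun w => (1 - eta) * sqn (dist k w)).
  by apply: measurable_funM.
have d20 w : 0 <= (1 - eta) * sqn (dist k w) by rewrite mulr_ge0 ?subr_ge0 ?dotp_ge0.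
have N0 : 0 <= 2 * gamma ^+ 2 * sigma2 / n%:R.
  by rewrite divr_ge0// mulr_ge0 ?sigma2_ge0// mulr_ge0// sqr_ge0.
have mh : measurable_fun setT (fun w => sqn (hybrid k 0 w)).
  by apply: measurable_dotp; exact: measurable_hybrid.
have mV : measurable_fun setT (fun w => (gamma / n%:R) ^+ 2 *
    \sum_(i < n) variance_bound i (iter k w)).
  apply: measurable_funM => //.
  apply: (@measurable_sum _ _ _ _ _ _ (fun i w => variance_bound i (iter k w))) => i.
  exact: measurable_variance_bound.
have V0 w : 0 <= (gamma / n%:R) ^+ 2 * \sum_(i < n) variance_bound i (iter k w).
  rewrite mulr_ge0 ?sqr_ge0// sumr_ge0// => i _; exact: variance_bound_ge0.
have := hybrid_le k (leqnn n).
under eq_integral do rewrite hybrid_all.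
under [X in (_ <= X)%E -> _]eq_integral do
  (under eq_bigl do rewrite ltn_ord).
move=> /(leeD2r (\int[P]_w (gamma / 2 * gap (iter k w))%:E)) /le_trans; apply.
rewrite -ge0_integralD_EFin//; last 2 first.
- exact: measurable_funD.
- by move=> w; rewrite addr_ge0 ?dotp_ge0.
have /le_trans : (\int[P]_w (sqn (hybrid k 0 w) +
      (gamma / n%:R) ^+ 2 * \sum_(i < n) variance_bound i (iter k w) +
      gamma / 2 * gap (iter k w))%:E <=
    \int[P]_w ((1 - eta) * sqn (dist k w) + 10 * L * gamma * sqn (mean_err k w) +
      2 * gamma ^+ 2 * sigma2 / n%:R)%:E)%E.
  apply: le_integral_EFin.
  - by apply: measurable_funD => //; exact: measurable_funD.
  - by apply: measurable_funD => //; exact: measurable_funD.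
  - by move=> w; rewrite !addr_ge0 ?dotp_ge0.
  - move=> w; rewrite hybrid0.
    apply: le_trans (virtual_descent (iter k w) (mean_err k w) gamma_gt0 gamma_le) _.
    rewrite -/(dist k w) !lerD2r ler_wpM2r ?dotp_ge0//; lra.
apply; rewrite ge0_integralD_EFin//; last 2 first.
- exact: measurable_funD.
- by move=> w; rewrite addr_ge0.
rewrite ge0_integralD_EFin// integral_cst_EFin ge0_integralZ_EFin ?subr_ge0//; last first.
  by move=> w; exact: dotp_ge0.
rewrite -addeA leeD2l// EFinD leeD2r//.
rewrite ge0_integralZ_EFin//; last 2 first.
- have mm : measurable_row (mean_err k).
    by apply: measurable_rowZ => //; exact: measurable_row_sum.
  exact: measurable_dotp.
- by move=> w; exact: dotp_ge0.
by rewrite [X in (_ <= X)%E]EFinM lee_wpmul2l// sqr_mean_err_le.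
Qed.

Lemma averaging_rate_bounds : 0 <= averaging_rate gamma mu /\
  averaging_rate gamma mu <= gamma * mu / 2 /\ averaging_rate gamma mu < 1.
Proof.
rewrite /averaging_rate le_min ge_min lexx/= gt_min; split; last first.
  by split => //; apply/orP; right; lra.
by apply/andP; split; [rewrite divr_ge0// mulr_ge0// ltW|lra].
Qed.

Let step_noise :=
  10 * L * gamma * (gamma ^+ 2 * Delta ^+ 2) + 2 * gamma ^+ 2 * sigma2 / n%:R.

Lemma sqr_dist0 : (\int[P]_w (sqn (dist 0 w))%:E = (sqn (x0 - xs))%:E)%E.
Proof.
have E w : dist 0 w = x0 - xs.
  rewrite /dist /mean_err big1// scaler0 subr0//.
under eq_integral do rewrite E.
by rewrite [LHS]integral_cst_EFin.
Qed.

(** Induction through [expected_descent]: the right side is finite once step [k] is, and the left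
    side is a sum of nonnegative integrals. *)
Lemma sqr_dist_fin_num k : (\int[P]_w (sqn (dist k w))%:E)%E \is a fin_num.
Proof.
have d0 k' : (0 <= \int[P]_w (sqn (dist k' w))%:E)%E.
  by apply: integral_ge0 => w _; rewrite lee_fin dotp_ge0.
elim: k => [|k IH]; first by rewrite sqr_dist0.
rewrite ge0_fin_numE//.
have [eta0 [eta_le eta1]] := averaging_rate_bounds.
have := expected_descent k eta_le (ltW eta1).
rewrite -(fineK IH) -EFinM -EFinD => /le_lt_trans H.
apply: le_lt_trans (H _ (ltry _)).
by rewrite leeDl// integral_ge0// => w _; rewrite lee_fin mulr_ge0// divr_ge0// ltW.
Qed.

Lemma expected_gap_fin_num k : (\int[P]_w (gap (iter k w))%:E)%E \is a fin_num.
Proof.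
have g2 : 0 < gamma / 2 by rewrite divr_gt0.
have I0 : (0 <= \int[P]_w (gap (iter k w))%:E)%E.
  by apply: integral_ge0 => w _; rewrite lee_fin.
have [eta0 [eta_le eta1]] := averaging_rate_bounds.
have := expected_descent k eta_le (ltW eta1).
rewrite -(fineK (sqr_dist_fin_num k)) -EFinM -EFinD (ge0_integralZ_EFin _ (ltW g2))//.
rewrite -(fineK (sqr_dist_fin_num k.+1)).
case: (integral _ _ _) I0 => [r| |]//= _.
by rewrite gt0_muley// lte_fin.
Qed.

Lemma expected_gap_le K :
  convex_function [set: convex_lmodType 'rV[R]_d] (loss fs) ->
  (\int[P]_w (gap (weighted_average (averaging_rate gamma mu) K (fun k => iter k w)))%:E <=
   (2 * sqn (x0 - xs) /
      (gamma * \sum_(0 <= k < K.+1) weight (averaging_rate gamma mu) k) +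
    20 * L * gamma ^+ 2 * Delta ^+ 2 + 4 * gamma * sigma2 / n%:R)%:E)%E.
Proof.
move=> cvx; have [eta0 [eta_le eta1]] := averaging_rate_bounds.
set eta := averaging_rate gamma mu in eta0 eta_le eta1 *.
pose A k := fine (\int[P]_w (sqn (dist k w))%:E).
pose G k := fine (\int[P]_w (gap (iter k w))%:E).
have A0 k : 0 <= A k.
  by rewrite fine_ge0// integral_ge0// => w _; rewrite lee_fin dotp_ge0.
have AG k : A k.+1 + gamma / 2 * G k <= (1 - eta) * A k + step_noise.
  have := expected_descent k eta_le (ltW eta1).
  rewrite (ge0_integralZ_EFin P (divr_ge0 (ltW gamma_gt0) (ler0n R 2)))//.
  apply: le_fine_recurrence; try exact: sqr_dist_fin_num.
  exact: expected_gap_fin_num.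
have tel := weighted_telescope eta1 A0 AG K.+1.
set W := \sum_(0 <= k < K.+1) weight eta k in tel *.
have Wp : 0 < W by exact: sum_weight_gt0.
have w0 k : 0 <= weight eta k by rewrite ltW// weight_gt0.
have [mi _] : (forall k, measurable_row (iter k)) /\ True.
  by split => // k; have [] := measurable_state k.
have mW : measurable_fun setT
    (fun w => \sum_(0 <= k < K.+1) weight eta k * gap (iter k w)).
  apply: (@measurable_sum _ _ _ _ _ _ (fun k w => weight eta k * gap (iter k w))) => k.
  exact: measurable_funM.
have W0 w : 0 <= \sum_(0 <= k < K.+1) weight eta k * gap (iter k w).
  by apply: sumr_ge0 => k _; rewrite mulr_ge0.
have /le_trans : (\int[P]_w (gap (weighted_average eta K (fun k => iter k w)))%:E <=
    \int[P]_w (W^-1 * \sum_(0 <= k < K.+1) weight eta k * gap (iter k w))%:E)%E.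
  apply: le_integral_EFin => //.
  - apply: measurable_funB => //; apply: measurable_loss => //.
    apply: measurable_rowZ => //; apply: measurable_row_sum => k.
    by apply: measurable_rowZ.
  - exact: measurable_funM.
  - move=> w; rewrite /gap lerBlDr.
    apply: le_trans (convex_weighted_average K _ cvx eta1) _; rewrite -/W.
    under [in leRHS]eq_bigr do rewrite mulrBr.
    by rewrite sumrB mulrBr -mulr_suml -/W mulKf ?gt_eqF// subrK.
apply; rewrite ge0_integralZ_EFin ?invr_ge0 ?(ltW Wp)//.
have -> : (\int[P]_w (\sum_(0 <= k < K.+1) weight eta k * gap (iter k w))%:E =
    (\sum_(0 <= k < K.+1) weight eta k * G k)%:E)%E.
  under eq_integral do rewrite -sumEFin.
  rewrite ge0_integral_sum//; last 2 first.
  - by move=> k; apply/measurable_EFinP; exact: measurable_funM.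
  - by move=> k w _; rewrite lee_fin mulr_ge0.
  rewrite -sumEFin; apply: eq_bigr => k _.
  by rewrite ge0_integralZ_EFin// EFinM fineK// expected_gap_fin_num.
rewrite -EFinM lee_fin; move: tel; rewrite {1}/A sqr_dist0/=.
move: (\sum_(0 <= k < K.+1) _ * _) => S.
have gW : 0 < gamma / 2 * W by rewrite mulr_gt0// divr_gt0.
(* The factor [2 / gamma] turns [step_noise] into [20 * L * gamma ^+ 2 * Delta ^+ 2 + 4 * gamma *
   sigma2 / n%:R]. *)
rewrite -(ler_pM2l (_ : 0 < (gamma / 2 * W)^-1)) ?invr_gt0//.
have -> : (gamma / 2 * W)^-1 * (gamma / 2 * S) = W^-1 * S.
  by field; rewrite !gt_eqF.
move=> /le_trans; apply; rewrite le_eqVlt; apply/orP; left; apply/eqP.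
rewrite /step_noise; field.
by rewrite !gt_eqF// nR_gt0.
Qed.

End ec_sgd_descent.

(** * Stepsizes *)

Section stepsizes.
Context {R : realType}.
Implicit Types (mu L M Lc r s Delta nn K ell gamma : R).

(** The last weight alone suffices, by [1 - eta <= expR (- eta)] raised to the power [K]; one extra
    factor [(1 - eta)^-1] is dropped. *)
Lemma sum_weight_ge_expR (eta : R) (K : nat) : eta < 1 -> 0 <= eta ->
  expR (eta * K%:R) <= \sum_(0 <= k < K.+1) weight eta k.
Proof.
move=> eta1 eta0; rewrite big_nat_recr//=.
apply: (@le_trans _ _ (weight eta K)); last first.
  by rewrite lerDr sumr_ge0// => k _; rewrite ltW// weight_gt0.
have e1 : 0 < 1 - eta by rewrite subr_gt0.
rewrite /weight -[leLHS]invrK -expRN lef_pV2 ?posrE ?expR_gt0 ?exprn_gt0//.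
apply: (@le_trans _ _ ((1 - eta) ^+ K)).
  by rewrite exprS ler_piMl ?exprn_ge0 ?(ltW e1)// lerBlDr lerDl.
rewrite -mulNr mulrC expRM_natl; apply: lerXn2r; rewrite ?nnegrE ?(ltW e1) ?expR_ge0//.
exact: expR_ge1Dx.
Qed.

(* With [1 / gamma] the sum of the three inverse stepsizes suggested by the
   terms of the bound, no case analysis on which term dominates is needed. *)
Lemma stepsize_convex M Lc L r s Delta nn K :
  0 < M -> M <= 8 * Lc -> 0 <= L -> 0 < r -> 0 <= s -> 0 <= Delta -> 0 < nn -> 0 < K ->
  exists gamma, 0 < gamma <= M^-1 /\
    2 * r ^+ 2 / (gamma * K) + 20 * L * gamma ^+ 2 * Delta ^+ 2 + 4 * gamma * s / nn <=
    22 * (Lc * r ^+ 2 / K + Num.sqrt (s * r ^+ 2 / (nn * K)) +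
      L `^ (1 / 3) * r `^ (4 / 3) * Delta `^ (2 / 3) / K `^ (2 / 3)).
Proof.
move=> M0 MLc L0 r0 s0 D0 n0 K0.
set S := Num.sqrt _; set T := _ / K `^ _.
have S0 : 0 <= S by exact: sqrtr_ge0.
have T0 : 0 <= T by rewrite divr_ge0 ?mulr_ge0 ?powR_ge0.
(* The noise levels [s / nn] and [L * Delta ^+ 2] are expressed through the target terms [S] and
   [T]. *)
have SE : s / nn = S ^+ 2 * K / r ^+ 2.
  rewrite sqr_sqrtr; last by rewrite divr_ge0 ?mulr_ge0 ?(ltW r0) ?(ltW n0) ?(ltW K0).
  by field; rewrite !gt_eqF.
have p3 (x : R) (a : R) : (x `^ (a / 3)) ^+ 3 = x `^ a.
  by rewrite -powR_mulrn ?powR_ge0// -powRrM divfK.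
have TE : L * Delta ^+ 2 = T ^+ 3 * K ^+ 2 / r ^+ 4.
  rewrite /T !exprMn exprVn !p3 powRr1//.
  rewrite -[4]/(4%:R) -[2]/(2%:R) !powR_mulrn ?(ltW r0) ?(ltW K0)//.
  by field; rewrite !gt_eqF.
(* With [g = den^-1], the first term splits exactly into multiples of [M * r ^+ 2 / K], [S] and [T],
   and both noise terms are controlled by [gS] and [gT]. The coefficients add up to 16, 6 and 22. *)
pose den := M + K * (S + T) / r ^+ 2.
have q0 : 0 <= K * (S + T) / r ^+ 2.
  by rewrite divr_ge0 ?sqr_ge0// mulr_ge0 ?addr_ge0// ltW.
have den0 : 0 < den by rewrite ltr_wpDr.
exists den^-1; split; first by rewrite invr_gt0 den0/= lef_pV2 ?posrE// lerDl.
set g := den^-1.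
have g0 : 0 < g by rewrite invr_gt0.
have gS : g * (K * S / r ^+ 2) <= 1.
  rewrite /g mulrC ler_pdivrMr// mul1r /den mulrDr mulrDl.
  have : 0 <= K * T / r ^+ 2 by rewrite divr_ge0 ?sqr_ge0// mulr_ge0// ltW.
  lra.
have gT : g * (K * T / r ^+ 2) <= 1.
  rewrite /g mulrC ler_pdivrMr// mul1r /den mulrDr mulrDl.
  have : 0 <= K * S / r ^+ 2 by rewrite divr_ge0 ?sqr_ge0// mulr_ge0// ltW.
  lra.
have gT0 : 0 <= g * (K * T / r ^+ 2).
  by rewrite mulr_ge0 ?(ltW g0)// divr_ge0 ?sqr_ge0// mulr_ge0// ltW.
have E1 : 2 * r ^+ 2 / (g * K) = 2 * (M * r ^+ 2 / K) + 2 * S + 2 * T.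
  by rewrite /g invfM invrK /den; field; rewrite !gt_eqF.
have E2 : 20 * L * g ^+ 2 * Delta ^+ 2 <= 20 * T.
  have -> : 20 * L * g ^+ 2 * Delta ^+ 2 = 20 * ((g * (K * T / r ^+ 2)) ^+ 2 * T).
    have -> : 20 * L * g ^+ 2 * Delta ^+ 2 = 20 * g ^+ 2 * (L * Delta ^+ 2) by ring.
    by rewrite TE; field; rewrite gt_eqF.
  by rewrite ler_pM2l// ler_piMl// exprn_ile1.
have E3 : 4 * g * s / nn <= 4 * S.
  have -> : 4 * g * s / nn = 4 * (g * (K * S / r ^+ 2) * S).
    have -> : 4 * g * s / nn = 4 * g * (s / nn) by ring.
    by rewrite SE; field; rewrite gt_eqF.
  by rewrite ler_pM2l// ler_piMl.
have E4 : M * r ^+ 2 / K <= 8 * (Lc * r ^+ 2 / K).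
  have -> : 8 * (Lc * r ^+ 2 / K) = 8 * Lc * (r ^+ 2 / K) by ring.
  by rewrite -mulrA ler_wpM2r// divr_ge0 ?sqr_ge0// ltW.
have E5 : 0 <= Lc * r ^+ 2 / K.
  by rewrite divr_ge0 ?(ltW K0)// mulr_ge0 ?sqr_ge0//; lra.
rewrite E1; lra.
Qed.

Lemma expR_le_of_ln (a x : R) : 0 < x -> - ln x <= a -> expR (- a) <= x.
Proof. by move=> x0 h; rewrite -[leRHS]lnK ?posrE// ler_expR lerNl. Qed.

(** With noise present, [gamma] is the smaller of [M^-1] and [8 * ell / (mu * K)]; lying below the
    latter bounds the noise terms. At [M^-1] the exponential is dominated by the target one since
    [M <= 8 * Lc]; at the other value it is [expR (- (4 * ell))], small enough to hide in the noise
    terms. *)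
Lemma stepsize_strongly_convex mu M Lc L r s Delta nn K ell :
  0 < mu -> 0 < M -> M <= 8 * Lc -> 0 <= L -> 0 <= r -> 0 <= s -> 0 <= Delta ->
  0 < nn -> 0 < K -> 1 <= ell ->
  `|ln K| + `|ln mu| + `|ln L| + `|ln nn| + `|ln r| + `|ln s| + `|ln Delta| <= ell ->
  exists gamma, 0 < gamma <= M^-1 /\
    2 * r ^+ 2 / gamma * expR (- (gamma * mu / 2 * K)) +
      20 * L * gamma ^+ 2 * Delta ^+ 2 + 4 * gamma * s / nn <=
    2000 * ell ^+ 2 * (Lc * r ^+ 2 * expR (- (1 / 16 * (mu / Lc) * K)) +
      s / (mu * nn * K) + L * Delta ^+ 2 / (mu ^+ 2 * K ^+ 2)).
Proof.
move=> mu0 M0 MLc L0 r0 s0 D0 n0 K0 ell1 hl.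
have Lc0 : 0 < Lc by lra.
set E := expR (- (1 / 16 * _ * _)); set S := s / _; set T := L * _ / _.
have mK0 : 0 < mu * K by exact: mulr_gt0.
have LD0 : 0 <= L * Delta ^+ 2 by rewrite mulr_ge0// sqr_ge0.
have S0 : 0 <= S by rewrite divr_ge0// ltW// !mulr_gt0.
have T0 : 0 <= T by rewrite divr_ge0// -exprMn sqr_ge0.
have E0 : 0 <= E by exact: expR_ge0.
have Q0 : 0 <= Lc * r ^+ 2 * E.
  by apply: mulr_ge0 => //; apply: mulr_ge0; [exact: ltW|exact: sqr_ge0].
have ell2 : 1 <= ell ^+ 2 by rewrite exprn_ege1.
have large : 2 * r ^+ 2 / M^-1 * expR (- (M^-1 * mu / 2 * K)) <= 16 * (Lc * r ^+ 2 * E).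
  rewrite invrK.
  have -> : 16 * (Lc * r ^+ 2 * E) = 2 * r ^+ 2 * (8 * Lc) * E by ring.
  apply: ler_pM; rewrite ?mulr_ge0 ?sqr_ge0 ?expR_ge0 ?(ltW M0)//.
    by rewrite ler_wpM2l// mulr_ge0 ?sqr_ge0.
  rewrite ler_expR lerN2 ler_wpM2r ?(ltW K0)//.
  have -> : 1 / 16 * (mu / Lc) = (8 * Lc)^-1 * mu / 2 by field; rewrite gt_eqF.
  by rewrite ler_wpM2r ?invr_ge0// ler_wpM2r ?(ltW mu0)// lef_pV2 ?posrE// mulr_gt0.
(* Here [1280 = 20 * 8 ^ 2], and [ell ^+ 2] comes from the squared stepsize in the compression
   term. *)
have small gamma : 0 < gamma -> gamma <= 8 * ell / (mu * K) ->
    20 * L * gamma ^+ 2 * Delta ^+ 2 + 4 * gamma * s / nn <= 1280 * ell ^+ 2 * (S + T).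
  move=> g0 gl.
  have h1 : gamma ^+ 2 <= (8 * ell / (mu * K)) ^+ 2.
    by rewrite ler_pXn2r ?nnegrE ?(ltW g0)// (le_trans (ltW g0)).
  have h2 : 20 * L * gamma ^+ 2 * Delta ^+ 2 <= 1280 * ell ^+ 2 * T.
    have -> : 1280 * ell ^+ 2 * T = 20 * (L * Delta ^+ 2) * (8 * ell / (mu * K)) ^+ 2.
      by rewrite /T; field; rewrite !gt_eqF.
    have -> : 20 * L * gamma ^+ 2 * Delta ^+ 2 = 20 * (L * Delta ^+ 2) * gamma ^+ 2 by ring.
    by rewrite ler_wpM2l// mulr_ge0// mulr_ge0 ?sqr_ge0.
  have h3 : 4 * gamma * s / nn <= 32 * ell * S.
    have -> : 32 * ell * S = 4 * (s / nn) * (8 * ell / (mu * K)).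
      by rewrite /S; field; rewrite !gt_eqF.
    have -> : 4 * gamma * s / nn = 4 * (s / nn) * gamma by ring.
    by rewrite ler_wpM2l// mulr_ge0// divr_ge0// ltW.
  have h4 : 32 * ell * S <= 1280 * ell ^+ 2 * S.
    by rewrite ler_wpM2r//; nra.
  lra.
have final X Y : X <= 16 * (Lc * r ^+ 2 * E) + 2 * (S + T) -> Y <= 1280 * ell ^+ 2 * (S + T) ->
    X + Y <= 2000 * ell ^+ 2 * (Lc * r ^+ 2 * E + S + T).
  move=> hX hY.
  have a1 : 16 * (Lc * r ^+ 2 * E) <= 2000 * ell ^+ 2 * (Lc * r ^+ 2 * E).
    by rewrite ler_wpM2r//; lra.
  have a2 : 2 * (S + T) <= 720 * ell ^+ 2 * (S + T).
    by rewrite ler_wpM2r ?addr_ge0//; lra.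
  lra.
(* Without noise nothing could absorb [expR (- (4 * ell))], but then [M^-1] costs nothing. *)
have [zero|nonzero] := pselect (s = 0 /\ L * Delta ^+ 2 = 0).
  have [sz Tz] := zero.
  exists M^-1; rewrite invr_gt0 M0 lexx; split => //.
  rewrite -addrA; apply: final.
    by apply: le_trans large _; rewrite lerDl mulr_ge0// addr_ge0.
  have -> : 20 * L * M^-1 ^+ 2 * Delta ^+ 2 + 4 * M^-1 * s / nn =
      20 * M^-1 ^+ 2 * (L * Delta ^+ 2) + 4 * M^-1 / nn * s by ring.
  rewrite Tz sz mulr0 mulr0 addr0; apply: mulr_ge0; last exact: addr_ge0.
  by apply: mulr_ge0; [exact: ler0n|exact: sqr_ge0].
have [le|gt] := leP M^-1 (8 * ell / (mu * K)).
  exists M^-1; rewrite invr_gt0 M0 lexx; split => //.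
  rewrite -addrA; apply: final; last by apply: small; rewrite ?invr_gt0.
  by apply: le_trans large _; rewrite lerDl mulr_ge0// addr_ge0.
set gamma := 8 * ell / (mu * K) in gt small *.
have g0 : 0 < gamma by rewrite divr_gt0 ?mulr_gt0//; lra.
exists gamma; rewrite g0 (ltW gt); split => //.
rewrite -addrA; apply: final; last exact: small.
apply: (@le_trans _ _ (2 * (S + T))); last first.
  by rewrite lerDr mulr_ge0.
have -> : gamma * mu / 2 * K = 4 * ell by rewrite /gamma; field; rewrite !gt_eqF.
have [->|rn0] := eqVneq r 0.
  by rewrite expr0n/= mulr0 !mul0r mulr_ge0 ?addr_ge0.
have rp : 0 < r by rewrite lt_neqAle eq_sym rn0.
have -> : 2 * r ^+ 2 / gamma * expR (- (4 * ell)) =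
    2 * (r ^+ 2 * (mu * K) / (8 * ell) * expR (- (4 * ell))).
  by rewrite /gamma; field; rewrite !gt_eqF//; lra.
rewrite ler_pM2l//.
apply: (@le_trans _ _ (r ^+ 2 * (mu * K) * expR (- (4 * ell)))).
  rewrite ler_wpM2r ?expR_ge0// ler_piMr ?mulr_ge0 ?sqr_ge0 ?(ltW mu0) ?(ltW K0)//.
  by rewrite invf_le1; lra.
have rmK : 0 < r ^+ 2 * (mu * K) by rewrite !mulr_gt0// exprn_gt0.
rewrite mulrC -ler_pdivlMr//.
have nl (a : R) : ln a <= `|ln a| /\ - ln a <= `|ln a| /\ 0 <= `|ln a|.
  by rewrite ler_norm -normrN ler_norm normrN normr_ge0.
have [[l1 [l2 l3]] [l4 [l5 l6]] [l7 [l8 l9]] [l10 [l11 l12]]] :=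
  And4 (nl K) (nl mu) (nl L) (nl nn).
have [[l13 [l14 l15]] [l16 [l17 l18]] [l19 [l20 l21]]] :=
  And3 (nl r) (nl s) (nl Delta).
(* The exponential hides in [S] if [s] is nonzero and in [T] otherwise. In either case no logarithm
   carries a coefficient above 3, within the budget [4 * ell]. *)
have [sz|sn0] := eqVneq s 0; last first.
  have sp : 0 < s by rewrite lt_neqAle eq_sym sn0.
  apply: (@le_trans _ _ (S / (r ^+ 2 * (mu * K)))); last first.
    by rewrite ler_wpM2r ?invr_ge0 ?(ltW rmK)// lerDl.
  have Sp : 0 < S by rewrite divr_gt0 ?mulr_gt0.
  apply: expR_le_of_ln; first by rewrite divr_gt0.
  rewrite ln_div ?posrE// /S ln_div ?posrE ?mulr_gt0// !lnM ?posrE ?mulr_gt0 ?exprn_gt0//.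
  lra.
have Tn0 : L * Delta ^+ 2 != 0 by apply/eqP => h; apply: nonzero.
have Lp : 0 < L.
  by rewrite lt_neqAle L0 andbT eq_sym; apply: contraNneq Tn0 => ->; rewrite mul0r.
have Dp : 0 < Delta.
  rewrite lt_neqAle D0 andbT eq_sym; apply: contraNneq Tn0 => ->.
  by rewrite expr0n mulr0.
apply: (@le_trans _ _ (T / (r ^+ 2 * (mu * K)))); last first.
  by rewrite ler_wpM2r ?invr_ge0 ?(ltW rmK)// lerDr.
have Tp : 0 < T by rewrite divr_gt0 ?mulr_gt0 ?exprn_gt0.
apply: expR_le_of_ln; first by rewrite divr_gt0.
rewrite ln_div ?posrE// /T ln_div ?posrE ?mulr_gt0 ?exprn_gt0//.
rewrite !lnM ?posrE ?mulr_gt0 ?exprn_gt0//; lra.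
Qed.

End stepsizes.

Theorem theorem3p3 (R : realType) :
  exists (B c : R) (q : nat), 0 < B /\ 0 < c /\
  forall (d n m : nat) (fs : 'I_n -> 'I_m -> 'rV[R]_d -> R)
    (D : 'I_n -> probability (m.-tuple R) R)
    (dZ : measure_display) (Z : measurableType dZ) (Q : probability Z R)
    (C : Z -> 'rV[R]_d -> 'rV[R]_d)
    (mu L calL Delta sigma2 : R) (x0 xs : 'rV[R]_d),
  (0 < n)%N -> (0 < m)%N ->
  (forall i j x, differentiable (fs i j) x) ->
  convex_function [set: convex_lmodType 'rV[R]_d] (loss fs) ->
  unique_minimizer (loss fs) xs ->
  0 <= mu -> quasi_strongly_convex mu (loss fs) xs ->
  0 <= L -> smooth L (loss fs) ->
  unit_mean D ->
  0 < calL -> expected_smoothness fs D calL xs ->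
  sigma_star2 fs D xs = sigma2%:E ->
  absolute_compression Q C Delta ->
  let R0 := enorm (x0 - xs) in
  let Lc := L + calL / n%:R in
  forall K : nat, (1 <= K)%N ->
  exists gamma : R, 0 < gamma <= (4 * L + 8 * calL / n%:R)^-1 /\
  forall (dO : measure_display) (Omega : measurableType dO)
    (P : probability Omega R)
    (xi : nat -> 'I_n -> Omega -> m.-tuple R)
    (zeta : nat -> 'I_n -> Omega -> Z),
  fresh_sampling P D Q xi zeta ->
  let x k w := ec_sgd_as fs C gamma x0 xi zeta k w in
  let xbar w :=
    weighted_average (averaging_rate gamma mu) K (fun k => x k w) in
  let gap := ('E_P[fun w => (loss fs (xbar w) - loss fs xs)%R])%E in
  (0 < mu ->
    (gap <= (B * log_size [:: K%:R; mu; L; calL; n%:R; R0; sigma2; Delta] ^+ q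
             * (Lc * R0 ^+ 2 * expR (- (c * (mu / Lc) * K%:R))
                + sigma2 / (mu * n%:R * K%:R)
                + L * Delta ^+ 2 / (mu ^+ 2 * K%:R ^+ 2)))%:E)%E) /\
  (mu = 0 -> x0 <> xs ->
    (gap <= (B * (Lc * R0 ^+ 2 / K%:R
                  + Num.sqrt (sigma2 * R0 ^+ 2 / (n%:R * K%:R))
                  + L `^ (1 / 3) * R0 `^ (4 / 3) * Delta `^ (2 / 3)
                    / K%:R `^ (2 / 3)))%:E)%E).
Proof.
(* The rate [1 / 16] combines [M <= 8 * Lc] with the halving in [gamma * mu / 2]; [2000] also covers
   the [22] of the case [mu = 0]. *)
exists 2000, (1 / 16), 2%N; split; first exact: ltr0n.
split; first by rewrite divr_gt0// ltr0n.
move=> d n m fs D dZ Z Q C mu L calL Delta sigma2 x0 xs n0 _ dfs cvx [xs_min _] mu0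
  qsc L0 smoothL mean1 calL0 es sE compC R0 Lc K K1.
have nR : (0 : R) < n%:R by rewrite ltr0n.
have KR : (0 : R) < K%:R by rewrite ltr0n.
have D0 : 0 <= Delta by case: compC.
have s0 : 0 <= sigma2 := sigma2_ge0 n0 dfs sE.
have cn0 : 0 < calL / n%:R by rewrite divr_gt0.
pose M := 4 * L + 8 * calL / n%:R.
have ME : M = 4 * L + 8 * (calL / n%:R) by rewrite /M mulrA.
have M0 : 0 < M by rewrite ME; lra.
have MLc : M <= 8 * Lc by rewrite ME /Lc; lra.
have R00 : 0 <= R0 by exact: enorm_ge0.
(* Uniform in [gamma] and in the probability space, so the stepsize can be fixed before any space is
   given. *)
have key gamma : 0 < gamma -> gamma <= M^-1 ->
    forall (dO : measure_display) (Omega : measurableType dO) (P : probability Omega R)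
      (xi : nat -> 'I_n -> Omega -> m.-tuple R) (zeta : nat -> 'I_n -> Omega -> Z),
    fresh_sampling P D Q xi zeta ->
    ('E_P[fun w => (loss fs (weighted_average (averaging_rate gamma mu) K
        (fun k => ec_sgd_as fs C gamma x0 xi zeta k w)) - loss fs xs)%R] <=
     (2 * R0 ^+ 2 /
        (gamma * \sum_(0 <= k < K.+1) weight (averaging_rate gamma mu) k) +
      20 * L * gamma ^+ 2 * Delta ^+ 2 + 4 * gamma * sigma2 / n%:R)%:E)%E.
  move=> g0 gM dO Omega P xi zeta fresh; rewrite unlock enorm_sqr.
  apply: (expected_gap_le n0 dfs xs_min mu0 qsc L0 smoothL mean1 calL0 es sE compC x0
    g0 _ fresh K cvx).
  by rewrite -/M -ler_pdivlMr// mul1r.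
have [mu_eq0|mun0] := eqVneq mu 0.
  (* For [x0 = xs] both claims are vacuous and any admissible stepsize will do; otherwise [R0 > 0],
     as division by [r ^+ 2] in [stepsize_convex] demands. *)
  have [x0E|x0n] := pselect (x0 = xs).
    exists M^-1; rewrite -/M invr_gt0 M0 lexx; split => // dO Omega P xi zeta _ x xbar gap.
    by split => [|_ /(_ x0E)//]; rewrite mu_eq0 ltxx.
  have R0p : 0 < R0.
    rewrite lt_neqAle R00 andbT eq_sym; apply/eqP => R0E; apply: x0n.
    by apply/eqP; rewrite -subr_eq0; apply/eqP/dotp_eq0; rewrite -enorm_sqr -/R0 R0E expr0n.
  have [gamma [/andP[g0 gM] bound]] := stepsize_convex M0 MLc L0 R0p s0 D0 nR KR.
  exists gamma; rewrite g0 gM; split => // dO Omega P xi zeta fresh x xbar gap.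
  split; first by rewrite mu_eq0 ltxx.
  move=> _ _; apply: le_trans (key gamma g0 gM _ _ _ _ _ fresh) _; rewrite lee_fin.
  set S := Lc * _ / _ + _ + _ in bound *.
  have S0 : 0 <= S.
    rewrite addr_ge0 ?divr_ge0 ?mulr_ge0 ?powR_ge0// addr_ge0 ?sqrtr_ge0//.
    by rewrite divr_ge0 ?(ltW KR)//; apply: mulr_ge0; [lra|exact: sqr_ge0].
  have : 22 * S <= 2000 * S by rewrite ler_wpM2r// ler_nat.
  apply: le_trans; apply: le_trans bound; rewrite !lerD2r.
  (* At [mu = 0] all weights are 1, and their sum [K.+1] is at least [K]. *)
  have -> : \sum_(0 <= k < K.+1) weight (averaging_rate gamma mu) k = K.+1%:R.
    have -> : averaging_rate gamma mu = 0.
      by rewrite /averaging_rate mu_eq0 mulr0 mul0r min_l.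
    under eq_bigr do rewrite /weight subr0 expr1n invr1.
    by rewrite sumr_const_nat subn0.
  rewrite ler_wpM2l ?mulr_ge0 ?sqr_ge0// lef_pV2 ?posrE ?mulr_gt0//.
  by rewrite ler_pM2l// ler_nat.
have mup : 0 < mu by rewrite lt_neqAle eq_sym mun0.
set ell := log_size _.
have lnE : ell = 1 + (`|ln K%:R| + (`|ln mu| + (`|ln L| + (`|ln calL| + (`|ln n%:R| +
    (`|ln R0| + (`|ln sigma2| + `|ln Delta|))))))).
  by rewrite /ell /log_size !big_cons big_nil addr0.
have nn (a : R) : 0 <= `|ln a| by exact: normr_ge0.
have ell1 : 1 <= ell by rewrite lnE lerDl !addr_ge0.
have lnle : `|ln K%:R| + `|ln mu| + `|ln L| + `|ln n%:R| + `|ln R0| + `|ln sigma2| +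
    `|ln Delta| <= ell.
  by rewrite lnE; have := nn calL; lra.
have [gamma [/andP[g0 gM] bound]] :=
  stepsize_strongly_convex mup M0 MLc L0 R00 s0 D0 nR KR ell1 lnle.
exists gamma; rewrite g0 gM; split => // dO Omega P xi zeta fresh x xbar gap.
split; last by move=> mu_eq0; rewrite mu_eq0 eqxx in mun0.
move=> _; apply: le_trans (key gamma g0 gM _ _ _ _ _ fresh) _; rewrite lee_fin.
apply: le_trans bound; rewrite !lerD2r.
(* For [R0 = 0] the first term vanishes; otherwise [x0 - xs] is a nonzero vector, which turns the
   comparison of [mu] with [L] into [mu <= 2 * L]. *)
have [->|R0n] := eqVneq R0 0; first by rewrite expr0n/= mulr0 !mul0r.
have R2p : 0 < R0 ^+ 2 by rewrite exprn_gt0// lt_neqAle eq_sym R0n.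
have muL : mu <= 2 * L.
  have := quasi_strong_convexity_le_smoothness L0 (differentiable_loss dfs) smoothL
    xs_min qsc (x0 - xs).
  by rewrite -enorm_sqr -/R0 ler_pM2r.
(* From [mu <= 2 * L] and [gamma * (4 * L) <= 1]: the minimum in [averaging_rate] is
   [gamma * mu / 2]. *)
have gmu : gamma * mu / 2 <= 1 / 4.
  have gL : gamma * (4 * L) <= 1.
    rewrite -ler_pdivlMr; last by lra.
    apply: le_trans gM _; rewrite mul1r lef_pV2 ?posrE//; [by rewrite ME; lra|lra].
  have := ler_wpM2l (ltW g0) muL; lra.
have -> : averaging_rate gamma mu = gamma * mu / 2 by rewrite /averaging_rate min_l.
have h0 : 0 <= gamma * mu / 2 by rewrite divr_ge0// mulr_ge0 ?(ltW g0).
have W := @sum_weight_ge_expR _ (gamma * mu / 2) K (le_lt_trans gmu _) h0.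
rewrite invfM mulrA ler_wpM2l//; first by rewrite divr_ge0 ?(ltW g0)// mulr_ge0 ?sqr_ge0.
rewrite expRN lef_pV2 ?posrE ?expR_gt0//; first by apply: W; lra.
by apply: sum_weight_gt0; lra.
Qed.
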